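(* Let $n\geq 4$ and let $d$ be a non-negative integer with $d<\left\lfloor \frac{n}{2}\right\rfloor$. Then $\mathrm{Aut}(W_n)$ has property $\mathrm{F}\mathcal{A}_d$: every action of $\mathrm{Aut}(W_n)$ by isometries on a complete $\mathrm{CAT}(0)$ space of covering dimension $d$ has a global fixed point.
   Context: $W_n$ denotes the universal Coxeter group of rank $n$, $W_n=\langle s_1,\dots,s_n\mid s_1^2,\dots,s_n^2\rangle\cong \mathbb{Z}_2*\cdots*\mathbb{Z}_2$ ($n$ factors), and $\mathrm{Aut}(W_n)$ its automorphism group. A group $G$ has property $\mathrm{F}\mathcal{A}_d$ if any action of $G$ by isometries on a complete $\mathrm{CAT}(0)$ space of covering dimension $d$ has a fixed point. *)

(* Defs.v *)
From Stdlib Require Import Reals Lra Lia List Bool Arith.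
Import ListNotations.
Open Scope R_scope.

(* Elements of W_n = Z_2 * ... * Z_2 (n factors, generators s_0..s_{n-1})
   are represented by their unique normal forms: reduced words, i.e. lists
   of letters < n with no two consecutive equal letters. *)
Fixpoint reducedb (n : nat) (s : list nat) : bool :=
  match s with
  | [] => true
  | a :: s' =>
      Nat.ltb a n &&
      match s' with [] => true | b :: _ => negb (Nat.eqb a b) end &&
      reducedb n s'
  end.

Definition W (n : nat) : Type := { s : list nat | reducedb n s = true }.

Definition push (a : nat) (v : list nat) : list nat :=
  match v with
  | [] => [a]
  | b :: v' => if Nat.eqb a b then v' else a :: v
  end.

Lemma push_reduced n a v :
  Nat.ltb a n = true -> reducedb n v = true -> reducedb n (push a v) = true.
Proof.
  intros Ha Hv. destruct v as [|b v']; simpl.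
  - rewrite Ha. reflexivity.
  - destruct (Nat.eqb a b) eqn:E.
    + simpl in Hv. apply andb_true_iff in Hv as [_ Hv]. exact Hv.
    + simpl. rewrite Ha, E. simpl. simpl in Hv. exact Hv.
Qed.

Lemma fold_push_reduced n u v :
  reducedb n u = true -> reducedb n v = true ->
  reducedb n (fold_right push v u) = true.
Proof.
  induction u as [|a u IH]; intros Hu Hv; simpl; [exact Hv|].
  simpl in Hu. apply andb_true_iff in Hu as [Hu1 Hu3].
  apply andb_true_iff in Hu1 as [Ha _].
  apply push_reduced; [exact Ha| apply IH; assumption].
Qed.

Definition Wmul {n : nat} (u v : W n) : W n :=
  exist _ (fold_right push (proj1_sig v) (proj1_sig u))
        (fold_push_reduced n _ _ (proj2_sig u) (proj2_sig v)).

Definition is_aut {n : nat} (f : W n -> W n) : Prop :=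
  (forall u v, f (Wmul u v) = Wmul (f u) (f v)) /\
  (exists g : W n -> W n, (forall u, g (f u) = u) /\ (forall u, f (g u) = u)).

Definition is_metric {X : Type} (dist : X -> X -> R) : Prop :=
  (forall x y, dist x y = 0 <-> x = y) /\
  (forall x y, dist x y = dist y x) /\
  (forall x y z, dist x z <= dist x y + dist y z).

Definition complete {X : Type} (dist : X -> X -> R) : Prop :=
  forall u : nat -> X,
    (forall e, 0 < e -> exists N, forall p q, (N <= p)%nat -> (N <= q)%nat ->
        dist (u p) (u q) < e) ->
    exists l, forall e, 0 < e -> exists N, forall p, (N <= p)%nat -> dist (u p) l < e.

Definition geodesic {X : Type} (dist : X -> X -> R) (x y : X) (c : R -> X) : Prop :=
  c 0 = x /\ c (dist x y) = y /\
  forall s t, 0 <= s <= dist x y -> 0 <= t <= dist x y ->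
    dist (c s) (c t) = Rabs (s - t).

(* CAT(0) (Bridson-Haefliger II.1.1): geodesic, and for every geodesic
   triangle and points p, q on it, d(p,q) <= d(pbar,qbar) in the Euclidean
   comparison triangle.  Two points of a triangle always lie on two sides
   issuing from a common vertex x; with a = d(x,y), b = d(x,z), c = d(y,z),
   p at distance s from x on [x,y], q at distance t from x on [x,z], the
   comparison distance satisfies (law of cosines)
     d(pbar,qbar)^2 = s^2 + t^2 - s t (a^2 + b^2 - c^2)/(a b). *)
Definition CAT0 {X : Type} (dist : X -> X -> R) : Prop :=
  (forall x y, exists c, geodesic dist x y c) /\
  (forall x y z c1 c2, geodesic dist x y c1 -> geodesic dist x z c2 ->
     forall s t, 0 <= s <= dist x y -> 0 <= t <= dist x z ->
     let a := dist x y in let b := dist x z in let c := dist y z in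
     (dist (c1 s) (c2 t))^2 <= s^2 + t^2 - s * t * (a^2 + b^2 - c^2) / (a * b)).

Definition is_open {X : Type} (dist : X -> X -> R) (U : X -> Prop) : Prop :=
  forall x, U x -> exists e, 0 < e /\ forall y, dist x y < e -> U y.

Definition covdim_le {X : Type} (dist : X -> X -> R) (k : nat) : Prop :=
  forall Us : list (X -> Prop),
    (forall U, In U Us -> is_open dist U) ->
    (forall x, exists U, In U Us /\ U x) ->
    exists Vs : list (X -> Prop),
      (forall V, In V Vs -> is_open dist V) /\
      (forall x, exists V, In V Vs /\ V x) /\
      (forall V, In V Vs -> exists U, In U Us /\ forall x, V x -> U x) /\
      (forall x (idx : list nat), NoDup idx ->
         (forall i, In i idx -> (i < length Vs)%nat /\ nth i Vs (fun _ => False) x) ->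
         (length idx <= S k)%nat).

(* covering dimension exactly d (the empty space has dimension -1) *)
Definition covdim_eq {X : Type} (dist : X -> X -> R) (d : nat) : Prop :=
  covdim_le dist d /\ inhabited X /\ (forall k, (k < d)%nat -> ~ covdim_le dist k).

Definition isometric_Aut_action {n : nat} {X : Type} (dist : X -> X -> R)
    (act : (W n -> W n) -> X -> X) : Prop :=
  (forall x, act (fun u => u) x = x) /\
  (forall f g, is_aut f -> is_aut g -> forall x, act (fun u => f (g u)) x = act f (act g x)) /\
  (forall f, is_aut f -> forall x y, dist (act f x) (act f y) = dist x y).

(* Main.v *)
(* A fixed point of the whole group is found by enlarging the group. Let G_k be
   the copy of Aut(W_k) generated by one partial conjugation, of s_2 by s_1, and the
   k - 1 adjacent transpositions of the first k letters. Leaving out one generator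
   leaves a finite group, or G_j times a finite group with j < k, so by induction and
   the Bruhat-Tits theorem any k - 1 of the generators have a common fixed point.
   There are q = [n/k] commuting copies of G_k, and q (k - 1) > d.

   A Helly-type theorem then gives a fixed point of one copy. Suppose that for each
   i <= q the fixed-point sets C(i,0), ..., C(i,k-1) have empty intersection. Coning along
   geodesics maps a product of q simplices of dimension k - 1 to X so that each face goes
   to the corresponding intersection of the sets C(i,b). Refine the cover by the sets
   avoiding C(1,a_1), ..., C(q,a_q) to one of order at most d + 1. A generalised
   Sperner lemma, proved with chains modulo 2 and a cup product, finds a
   small simplex with q (k - 1) + 1 > d + 1 distinct labels, that is, a point in too many
   members of the refinement.

   Finally G_n is all of Aut(W_n). An automorphism f maps s_a to w_a c_a w_a^-1; if some
   w_b c_b is a prefix of w_a c_a, precomposing with the partial conjugation of s_a by s_b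
   makes f shorter, and otherwise f(x) starts with w_a c_a whenever x starts with s_a, which
   forces f to permute the generators. *)

(* The bound comes from rank two: with [q = [n/k]] the number [q (k - 1)] is at least [[n/2]] for
   every [k] from 2 to [n], with equality at [k = 2]. A single copy of G_k would only serve for
   [k - 1 > d], which already fails at [k = 2] when [d >= 1]; several copies raise the dimension of
   the product of simplices. The copies are conjugate under permutations of the letters, so it does
   not matter which of them gets the fixed point. [X] need not be locally compact, and its dimension
   is known only through finite open covers. The cones are therefore kept as finite chains of
   points, of arbitrarily fine mesh, inside one totally bounded set; that set has a Lebesgue number
   because [X] is complete. Coefficients modulo 2 avoid orientations, and a cup product of one
   cochain per factor replaces a triangulation of the product of simplices. *)
Require Import Defs.
From Stdlib Require Import Reals Lra Lia List Bool Arith Permutation Sorted.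
From Stdlib Require Import ClassicalEpsilon FunctionalExtensionality Eqdep_dec.
Import ListNotations.
Open Scope R_scope.

(** * Chains modulo 2 *)

(* A chain is a list of tuples. Two chains are equal modulo 2 when every
   [par phi] agrees on them, which needs no decidable equality of points. *)
Fixpoint par {A : Type} (phi : A -> bool) (l : list A) : bool :=
  match l with
  | [] => false
  | x :: l' => xorb (phi x) (par phi l')
  end.

Lemma par_app {A} (phi : A -> bool) l l' :
  par phi (l ++ l') = xorb (par phi l) (par phi l').
Proof.
  induction l; simpl; [now destruct (par phi l')|]. rewrite IHl.
  now rewrite xorb_assoc.
Qed.

Lemma par_map {A B} (phi : B -> bool) (g : A -> B) l :
  par phi (map g l) = par (fun x => phi (g x)) l.
Proof. induction l; simpl; congruence. Qed.

Lemma par_flat_map {A B} (phi : B -> bool) (g : A -> list B) l :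
  par phi (flat_map g l) = par (fun x => par phi (g x)) l.
Proof. induction l; simpl; [reflexivity|]. rewrite par_app. congruence. Qed.

Lemma par_ext_in {A} (phi psi : A -> bool) l :
  (forall x, In x l -> phi x = psi x) -> par phi l = par psi l.
Proof.
  induction l; simpl; intros H; [reflexivity|].
  rewrite H, IHl by auto. reflexivity.
Qed.

Lemma par_ext {A} (phi psi : A -> bool) l :
  (forall x, phi x = psi x) -> par phi l = par psi l.
Proof. intros H. apply par_ext_in. auto. Qed.

Lemma par_false {A} (l : list A) : par (fun _ => false) l = false.
Proof. induction l; simpl; auto. Qed.

Lemma par_false_in {A} (phi : A -> bool) l :
  (forall x, In x l -> phi x = false) -> par phi l = false.
Proof. intros H. rewrite (par_ext_in _ (fun _ => false)); [apply par_false | exact H]. Qed.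

Lemma par_xor {A} (phi psi : A -> bool) l :
  par (fun x => xorb (phi x) (psi x)) l = xorb (par phi l) (par psi l).
Proof.
  induction l; simpl; [reflexivity|]. rewrite IHl.
  destruct (phi a), (psi a), (par phi l), (par psi l); reflexivity.
Qed.

Lemma par_andl {A} (phi : A -> bool) c l :
  par (fun x => c && phi x) l = c && par phi l.
Proof. destruct c; simpl; [reflexivity | apply par_false]. Qed.

Lemma par_true_ex {A} (phi : A -> bool) l :
  par phi l = true -> exists x, In x l /\ phi x = true.
Proof.
  induction l; simpl; [discriminate|]. destruct (phi a) eqn:E; intros H.
  - exists a; auto.
  - destruct IHl as [x [H1 H2]]; [now destruct (par phi l)|]. exists x; auto.
Qed.

(** The terms of the simplicial boundary of an ordered tuple, one for each position, so that
    repeated entries count separately. *)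
Fixpoint dels {A : Type} (l : list A) : list (list A) :=
  match l with
  | [] => []
  | x :: l' => l' :: map (cons x) (dels l')
  end.

Lemma dels_length {A} (l l' : list A) : In l' (dels l) -> length l = S (length l').
Proof.
  revert l'; induction l as [|x l IH]; simpl; intros l' H; [contradiction|].
  destruct H as [<-|H]; [reflexivity|].
  apply in_map_iff in H as [y [<- Hy]]. simpl. now rewrite (IH y Hy).
Qed.

Lemma dels_incl {A} (l l' : list A) : In l' (dels l) -> incl l' l.
Proof.
  revert l'; induction l as [|x l IH]; simpl; intros l' H; [contradiction|].
  destruct H as [<-|H]; [now apply incl_tl, incl_refl|].
  apply in_map_iff in H as [y [<- Hy]]. intros z [<-|Hz]; [now left|].
  right. now apply (IH y Hy).
Qed.

Lemma dels_map {A B} (g : A -> B) l : dels (map g l) = map (map g) (dels l).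
Proof.
  induction l; simpl; [reflexivity|]. rewrite IHl, !map_map. reflexivity.
Qed.

Lemma dels_NoDup {A} (l l' : list A) : NoDup l -> In l' (dels l) -> NoDup l'.
Proof.
  revert l'; induction l as [|x l IH]; simpl; intros l' N H; [contradiction|].
  inversion N as [|? ? Hx Hl]; subst.
  destruct H as [<-|H]; [assumption|].
  apply in_map_iff in H as [y [<- Hy]]. constructor; [|auto].
  intro Hin. apply Hx. now apply (dels_incl l y).
Qed.

Lemma dels_missing {A} (l l' : list A) :
  NoDup l -> In l' (dels l) -> exists x, In x l /\ ~ In x l'.
Proof.
  revert l'; induction l as [|x l IH]; simpl; intros l' N H; [contradiction|].
  inversion N as [|? ? Hx Hl]; subst.
  destruct H as [<-|H]; [exists x; auto|].
  apply in_map_iff in H as [y [<- Hy]].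
  destruct (IH y Hl Hy) as [z [Hz Hz']].
  exists z. split; [now right|]. intros [<-|Hin]; auto.
Qed.

(** Two deletions made in either order leave the same tuple, so the terms cancel in pairs: the
    boundary of a boundary is zero. *)
Lemma par_dels_dels {A} (phi : list A -> bool) l :
  par phi (flat_map dels (dels l)) = false.
Proof.
  revert phi; induction l as [|x l IH]; intros phi; simpl; [reflexivity|].
  rewrite par_app, par_flat_map, par_map.
  rewrite (par_ext (fun l' => par phi (dels (x :: l')))
      (fun l' => xorb (phi l') (par (fun r => phi (x :: r)) (dels l'))))
    by (intros; simpl; now rewrite par_map).
  rewrite par_xor.
  rewrite <- (par_flat_map (fun r => phi (x :: r)) dels), IH.
  now rewrite xorb_false_r, xorb_nilpotent.
Qed.

Lemma par_dels_perm {A} (phi : list A -> bool) l l' :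
  Permutation l l' ->
  (forall m m', Permutation m m' -> phi m = phi m') ->
  par phi (dels l) = par phi (dels l').
Proof.
  intros P. revert phi. induction P; intros phi H; simpl.
  - reflexivity.
  - rewrite !par_map, (H l l') by assumption. f_equal.
    apply (IHP (fun m => phi (x :: m))). intros. apply H. now constructor.
  - rewrite !par_map, <- !xorb_assoc, (xorb_comm (phi _) (phi _)). f_equal.
    apply par_ext. intros. apply H. constructor.
  - now rewrite IHP1, IHP2.
Qed.

(** * Prisms and cones *)

(** The standard triangulation of a simplex times an interval, with one end mapped by [f] and the
    other by [g]. *)
Fixpoint prism {A B : Type} (f g : A -> B) (l : list A) : list (list B) :=
  match l with
  | [] => []
  | x :: l' => (f x :: g x :: map g l') :: map (cons (f x)) (prism f g l')
  end.

(** The chain homotopy formula. Neighbouring simplices of the prism share a wall, which cancels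
    modulo 2; the two ends and the prism over the boundary remain. *)
Lemma prism_boundary {A B} (f g : A -> B) l (phi : list B -> bool) :
  par phi (flat_map dels (prism f g l)) =
  xorb (xorb (phi (map f l)) (phi (map g l))) (par phi (flat_map (prism f g) (dels l))).
Proof.
  revert phi. induction l as [|x l IH]; intros phi.
  - simpl. now destruct (phi []).
  - specialize (IH (fun m => phi (f x :: m))).
    rewrite !par_flat_map in *. cbn [prism dels par map].
    rewrite !par_map.
    rewrite (par_ext (fun m => par phi (dels (f x :: m)))
       (fun m => xorb (phi m) (par (fun r => phi (f x :: r)) (dels m))))
      by (intros; simpl; now rewrite par_map).
    rewrite (par_ext (fun m => par phi (prism f g (x :: m)))
       (fun m => xorb (phi (f x :: g x :: map g m)) (par (fun r => phi (f x :: r)) (prism f g m))))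
      by (intros; simpl; now rewrite par_map).
    rewrite !par_xor, IH.
    change (par phi (dels (f x :: g x :: map g l))) with
     (xorb (phi (g x :: map g l)) (xorb (phi (f x :: map g l))
       (par phi (map (cons (f x)) (map (cons (g x)) (dels (map g l))))))).
    rewrite dels_map, !par_map.
    set (a := par _ (dels l)). set (b := par (fun m => _) (dels l)).
    set (c := par phi (prism f g l)).
    destruct (phi (g x :: map g l)), (phi (f x :: map g l)), (phi (f x :: map f l)), a, b, c;
      reflexivity.
Qed.

Lemma prism_length {A B} (f g : A -> B) l m :
  In m (prism f g l) -> length m = S (length l).
Proof.
  revert m; induction l as [|x l IH]; simpl; intros m H; [contradiction|].
  destruct H as [<-|H]; [simpl; now rewrite length_map|].
  apply in_map_iff in H as [y [<- Hy]]. simpl. now rewrite (IH y Hy).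
Qed.

Lemma prism_in {A B} (f g : A -> B) l m y :
  In m (prism f g l) -> In y m -> exists x, In x l /\ (y = f x \/ y = g x).
Proof.
  revert m; induction l as [|x l IH]; simpl; intros m H Hy; [contradiction|].
  destruct H as [<-|H].
  - destruct Hy as [<-|[<-|Hy]]; [exists x; auto..|].
    apply in_map_iff in Hy as [z [<- Hz]]. exists z; auto.
  - apply in_map_iff in H as [w [<- Hw]]. destruct Hy as [<-|Hy]; [exists x; auto|].
    destruct (IH w Hw Hy) as [z [Hz Hz']]. exists z; auto.
Qed.

(* The trace of the homotopy [h] from the identity at time 0 to time [K],
   closed off by the cone with apex [p]. *)
Definition fill {A : Type} (h : nat -> A -> A) (K : nat) (p : A) (z : list (list A)) :
  list (list A) :=
  flat_map (fun s => flat_map (prism (h s) (h (S s))) z) (seq 0 K)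
  ++ map (fun t => p :: map (h K) t) z.

(** As [z] is a cycle, the prisms over its boundary cancel, so the slices telescope from [z] at time
    0 to its image at time [K], which is also the base of the cone. *)
Lemma fill_boundary {A} (h : nat -> A -> A) K p z (phi : list A -> bool) :
  (forall x, h 0%nat x = x) ->
  (forall psi : list A -> bool, par psi (flat_map dels z) = false) ->
  par phi (flat_map dels (fill h K p z)) = par phi z.
Proof.
  intros H0 Hz. unfold fill. rewrite flat_map_app, par_app.
  assert (H1 : par phi (flat_map dels (flat_map
      (fun s => flat_map (prism (h s) (h (S s))) z) (seq 0 K))) =
    xorb (par phi z) (par (fun t => phi (map (h K) t)) z)).
  { induction K as [|K IH].
    - simpl. rewrite (par_ext (fun t => phi (map (h 0%nat) t)) phi).
      + now rewrite xorb_nilpotent.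
      + intros t. f_equal. rewrite (map_ext _ (fun x => x) H0). apply map_id.
    - rewrite seq_S, flat_map_app, flat_map_app, par_app, IH. simpl.
      rewrite app_nil_r, !par_flat_map.
      rewrite (par_ext (fun t => par (fun x => par phi (dels x)) (prism (h K) (h (S K)) t)) (fun t => xorb (xorb (phi (map (h K) t)) (phi (map (h (S K)) t)))
         (par (fun r => par phi (prism (h K) (h (S K)) r)) (dels t)))).
      + rewrite !par_xor. rewrite <- (par_flat_map _ dels), Hz.
        destruct (par phi z), (par (fun t => phi (map (h K) t)) z),
          (par (fun t => phi (map (h (S K)) t)) z); reflexivity.
      + intros t. rewrite <- par_flat_map, <- (par_flat_map phi (prism _ _)). apply prism_boundary. }
  rewrite H1, par_flat_map, par_map. simpl.
  rewrite (par_ext (fun t => xorb _ _) (fun t => xorb (phi (map (h K) t))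
     (par (fun r => phi (p :: map (h K) r)) (dels t)))).
  - rewrite par_xor, <- (par_flat_map _ dels), Hz.
    destruct (par phi z), (par (fun t => phi (map (h K) t)) z); reflexivity.
  - intros t. now rewrite dels_map, !par_map.
Qed.

Lemma fill_in {A} (h : nat -> A -> A) K p z m :
  In m (fill h K p z) ->
  (exists s t, (s < K)%nat /\ In t z /\ In m (prism (h s) (h (S s)) t)) \/
  (exists t, In t z /\ m = p :: map (h K) t).
Proof.
  unfold fill. rewrite in_app_iff, in_flat_map, in_map_iff.
  intros [[s [Hs Hm]]|[t [Ht Hm]]].
  - left. apply in_flat_map in Hm as [t [Ht Hm]]. exists s, t.
    apply in_seq in Hs. repeat split; auto; lia.
  - right. exists t. auto.
Qed.

(** * Faces of a product of simplices *)

(* The list [L_1; ...; L_q] stands for the face of a product of [q] simplices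
   whose [i]-th factor is spanned by the vertices in [L_i]. *)
Fixpoint dim (I : list (list nat)) : nat :=
  match I with
  | [] => 0
  | L :: I' => pred (length L) + dim I'
  end.

(** A factor with a single vertex contributes no facet, because every factor of a face must keep a
    vertex. *)
Definition proper_dels (L : list nat) : list (list nat) :=
  match L with
  | _ :: _ :: _ => dels L
  | _ => []
  end.

Fixpoint facets (I : list (list nat)) : list (list (list nat)) :=
  match I with
  | [] => []
  | L :: I' => map (fun L' => L' :: I') (proper_dels L) ++ map (cons L) (facets I')
  end.

Definition face (I : list (list nat)) : Prop := Forall (fun L => L <> [] /\ NoDup L) I.

Lemma proper_dels_in L L' : In L' (proper_dels L) -> In L' (dels L) /\ L' <> [].
Proof.
  destruct L as [|a [|b L]]; simpl; try tauto.
  intros H. split; [exact H|]. destruct H as [<-|H]; [discriminate|].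
  destruct H as [<-|H]; [discriminate|].
  apply in_map_iff in H as [? [<- ?]]. discriminate.
Qed.

Lemma facets_length I J : In J (facets I) -> length J = length I.
Proof.
  revert J; induction I as [|L I IH]; simpl; intros J H; [contradiction|].
  apply in_app_iff in H as [H|H]; apply in_map_iff in H as [y [<- Hy]]; simpl; auto.
Qed.

Lemma facets_dim I J : In J (facets I) -> dim I = S (dim J).
Proof.
  revert J; induction I as [|L I IH]; simpl; intros J H; [contradiction|].
  apply in_app_iff in H as [H|H]; apply in_map_iff in H as [y [<- Hy]]; simpl.
  - apply proper_dels_in in Hy as [Hy Hn]. apply dels_length in Hy.
    destruct y; [congruence|]. simpl in *. lia.
  - rewrite (IH y Hy). lia.
Qed.

Lemma facets_face I J : face I -> In J (facets I) -> face J.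
Proof.
  revert J; induction I as [|L I IH]; simpl; intros J F H; [contradiction|].
  inversion F as [|? ? [H1 H2] HI]; subst.
  apply in_app_iff in H as [H|H]; apply in_map_iff in H as [y [<- Hy]].
  - apply proper_dels_in in Hy as [Hy Hn]. constructor; [|assumption].
    split; [assumption|]. now apply (dels_NoDup L).
  - constructor; [auto|]. now apply IH.
Qed.

Lemma facets_incl I J i : In J (facets I) -> incl (nth i J []) (nth i I []).
Proof.
  revert J i; induction I as [|L I IH]; simpl; intros J i H; [contradiction|].
  apply in_app_iff in H as [H|H]; apply in_map_iff in H as [y [<- Hy]]; destruct i;
    simpl; auto using incl_refl.
  apply proper_dels_in in Hy as [Hy Hn]. now apply dels_incl.
Qed.

(** Deletions in two different factors commute and so occur twice; two deletions in the same factor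
    cancel as in a simplex. *)
Lemma par_facets_facets (phi : list (list nat) -> bool) I :
  par phi (flat_map facets (facets I)) = false.
Proof.
  revert phi; induction I as [|L I IH]; intros phi; simpl; [reflexivity|].
  rewrite flat_map_app, par_app, !par_flat_map, !par_map. simpl.
  rewrite (par_ext (fun L' => par phi (_ ++ _)) (fun L' => xorb (par (fun M => phi (M :: I)) (proper_dels L'))
     (par (fun J => phi (L' :: J)) (facets I)))).
  2: { intros. rewrite par_app, !par_map. reflexivity. }
  rewrite (par_ext (fun J => par phi (_ ++ _)) (fun J => xorb (par (fun M => phi (M :: J)) (proper_dels L))
     (par (fun K => phi (L :: K)) (facets J)))).
  2: { intros. rewrite par_app, !par_map. reflexivity. }
  rewrite !par_xor.
  rewrite <- (par_flat_map (fun K => phi (L :: K)) facets), IH.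
  assert (E : par (fun L' => par (fun M => phi (M :: I)) (proper_dels L')) (proper_dels L) = false).
  { destruct L as [|a [|b [|c L]]]; [reflexivity..|].
    rewrite <- (par_dels_dels (fun M => phi (M :: I)) (a :: b :: c :: L)).
    rewrite par_flat_map. apply par_ext_in. intros x Hx.
    change (proper_dels (a :: b :: c :: L)) with (dels (a :: b :: c :: L)) in Hx.
    apply dels_length in Hx. destruct x as [|x1 [|x2 x]]; try discriminate. reflexivity. }
  rewrite E.
  assert (S : forall (l : list (list nat)) (l' : list (list (list nat))),
    par (fun x => par (fun y => phi (x :: y)) l') l = par (fun y => par (fun x => phi (x :: y)) l) l').
  { intros l l'. induction l; simpl.
    - now rewrite par_false.
    - now rewrite IHl, par_xor. }
  rewrite S, xorb_false_l, xorb_false_r. apply xorb_nilpotent.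
Qed.

(** An edge has two end points. The parity matters because the boundary of a one-point tuple is the
    empty tuple, so a 0-chain is a cycle only if it has an even number of terms. *)
Lemma par_facets_one I c : dim I = 1%nat -> par (fun _ => c) (facets I) = false.
Proof.
  induction I as [|L I IH]; simpl; [discriminate|]. intros H.
  rewrite par_app, !par_map.
  destruct L as [|a [|b [|e L]]]; simpl in *; try lia; auto.
  assert (Hf : facets I = []).
  { destruct (facets I) as [|J l] eqn:E; [reflexivity|].
    assert (In J (facets I)) by (rewrite E; now left).
    apply facets_dim in H0. lia. }
  rewrite Hf. now destruct c.
Qed.

(* The first facet in the list is the one used to peel off a dimension. *)
Lemma facets_head I :
  (0 < dim I)%nat -> face I ->
  exists pre b L post rest, L <> [] /\ I = pre ++ (b :: L) :: post /\
    facets I = (pre ++ L :: post) :: rest /\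
    forall J, In J rest -> exists i e, In e (nth i (pre ++ L :: post) []) /\ ~ In e (nth i J []).
Proof.
  induction I as [|L I IH]; simpl; [lia|]. intros H F.
  inversion F as [|? ? [HL1 HL2] HF]; subst.
  destruct L as [|a [|b L]]; [congruence| |].
  - destruct (IH H HF) as (pre & b & L & post & rest & H1 & H2 & H3 & H4).
    exists ([a] :: pre), b, L, post, (map (cons [a]) rest).
    split; [assumption|]. split; [now rewrite H2|]. simpl. split; [now rewrite H3|].
    intros J HJ. apply in_map_iff in HJ as [J' [<- HJ']].
    destruct (H4 J' HJ') as (i & e & He). exists (S i), e. exact He.
  - exists [], a, (b :: L), I. eexists. split; [discriminate|].
    split; [reflexivity|]. split; [reflexivity|].
    intros J HJ. apply in_app_iff in HJ as [HJ|HJ].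
    + apply in_map_iff in HJ as [M [<- HM]].
      change (In M (map (cons a) (dels (b :: L)))) in HM.
      apply in_map_iff in HM as [M' [<- HM']].
      inversion HL2 as [|? ? Ha Hb]; subst.
      destruct (dels_missing _ _ Hb HM') as [x [Hx Hx']].
      exists 0%nat, x. split; [exact Hx|]. simpl. intros [<-|Hin]; auto.
    + apply in_map_iff in HJ as [J' [<- HJ']].
      pose proof HJ' as HJ2.
      assert (G : forall I J, face I -> In J (facets I) -> exists i e, In e (nth i I []) /\ ~ In e (nth i J [])).
      { clear. induction I as [|L I IH]; simpl; intros J F H; [contradiction|].
        inversion F as [|? ? [HL1 HL2] HF]; subst.
        apply in_app_iff in H as [H|H]; apply in_map_iff in H as [y [<- Hy]].
        - apply proper_dels_in in Hy as [Hy _].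
          destruct (dels_missing _ _ HL2 Hy) as [x Hx]. exists 0%nat, x. exact Hx.
        - destruct (IH y HF Hy) as (i & e & He). exists (S i), e. exact He. }
      destruct (G I J' HF HJ') as (i & e & He). exists (S i), e. exact He.
Qed.

(** * A fundamental cochain of the product *)

(** When [L] has no repetition and [l] has the same length, this is the cochain that recognises the
    tuples whose labels run once through [L]. *)
Definition surj (L l : list nat) : bool :=
  forallb (fun b => existsb (Nat.eqb b) l) L.

Lemma surj_spec L l : surj L l = true <-> incl L l.
Proof.
  unfold surj. rewrite forallb_forall. split; intros H x Hx.
  - specialize (H x Hx). apply existsb_exists in H as [y [Hy E]].
    apply Nat.eqb_eq in E. now subst.
  - apply existsb_exists. exists x. split; [now apply H | apply Nat.eqb_refl].
Qed.

Lemma surj_perm L l l' : Permutation l l' -> surj L l = surj L l'.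
Proof.
  intros P. apply eq_true_iff_eq. rewrite !surj_spec.
  split; intros H x Hx; [apply (Permutation_in _ P) | apply (Permutation_in _ (Permutation_sym P))]; auto.
Qed.

Definition outside (L l : list nat) : bool :=
  existsb (fun e => negb (existsb (Nat.eqb e) L)) l.

Lemma outside_false L l : incl l L -> outside L l = false.
Proof.
  intros H. destruct (outside L l) eqn:E; [|reflexivity].
  apply existsb_exists in E as [e [He E]]. apply negb_true_iff in E.
  assert (existsb (Nat.eqb e) L = true); [|congruence].
  apply existsb_exists. exists e. split; [now apply H | apply Nat.eqb_refl].
Qed.

(** The parity count of Sperner's lemma. If [l] covers [L], its one surplus entry either lies
    outside [L], and then only its deletion keeps [L] covered, or repeats a vertex, and then exactly
    two deletions do. *)
Lemma par_surj_dels L l :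
  NoDup L -> length l = S (length L) ->
  par (surj L) (dels l) = surj L l && outside L l.
Proof.
  intros N Hl. destruct (surj L l) eqn:S.
  - rewrite surj_spec in S.
    assert (P : exists e, Permutation l (e :: L)).
    { revert l Hl S. induction L as [|a L IH]; intros l Hl S.
      - destruct l as [|e [|? ?]]; try discriminate. exists e. apply Permutation_refl.
      - assert (Ha : In a l) by (apply S; now left).
        apply in_split in Ha as (l1 & l2 & ->).
        inversion N; subst.
        destruct (IH H2 (l1 ++ l2)) as [e He].
        + rewrite length_app in *. simpl in Hl. lia.
        + intros x Hx. specialize (S x (or_intror Hx)).
          apply in_app_iff in S as [S|[S|S]]; [apply in_app_iff; now left| |apply in_app_iff; now right].
          subst. contradiction.
        + exists e. rewrite <- Permutation_middle, He. constructor. }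
    destruct P as [e P].
    rewrite (par_dels_perm _ _ _ P) by (intros; now apply surj_perm).
    simpl.
    replace (outside L l) with (negb (existsb (Nat.eqb e) L)).
    2: { unfold outside. apply eq_true_iff_eq. rewrite existsb_exists.
      split.
      - intros H. exists e. split; [|exact H].
        apply (Permutation_in _ (Permutation_sym P)). now left.
      - intros [x [Hx H]]. apply (Permutation_in _ P) in Hx as [<-|Hx]; [exact H|].
        apply negb_true_iff in H.
        assert (existsb (Nat.eqb x) L = true); [|congruence].
        apply existsb_exists. exists x. split; [exact Hx | apply Nat.eqb_refl]. }
    rewrite par_map.
    replace (surj L L) with true by (symmetry; apply surj_spec, incl_refl).
    destruct (existsb (Nat.eqb e) L) eqn:E; simpl.
    + apply existsb_exists in E as [e' [He E]]. apply Nat.eqb_eq in E. subst e'.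
      replace (par (fun x => surj L (e :: x)) (dels L)) with true; [reflexivity|].
      symmetry. apply in_split in He as (l1 & l2 & ->).
      assert (P2 : Permutation (l1 ++ e :: l2) (e :: l1 ++ l2))
        by (symmetry; apply Permutation_middle).
      rewrite (par_dels_perm _ _ _ P2).
      2: { intros. apply surj_perm. now constructor. }
      simpl. rewrite par_map.
      rewrite par_false_in, xorb_false_r.
      * apply surj_spec. intros x Hx. now apply (Permutation_in _ P2).
      * intros x Hx. destruct (surj _ (e :: e :: x)) eqn:E; [|reflexivity].
        rewrite surj_spec in E. apply (Permutation_NoDup P2) in N.
        inversion N as [|? ? N1 N2]; subst.
        destruct (dels_missing _ _ N2 Hx) as [y [Hy Hy']].
        exfalso. assert (In y (e :: e :: x)) as [<-|[<-|?]].
        { apply E. apply (Permutation_in _ (Permutation_sym P2)). now right. }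
        -- contradiction. -- contradiction. -- contradiction.
    + rewrite par_false_in; [reflexivity|]. intros x Hx.
      destruct (surj L (e :: x)) eqn:E2; [|reflexivity].
      rewrite surj_spec in E2. destruct (dels_missing _ _ N Hx) as [y [Hy Hy']].
      exfalso. destruct (E2 y Hy) as [->|?]; [|contradiction].
      assert (existsb (Nat.eqb y) L = true); [|congruence].
      apply existsb_exists. exists y. split; [exact Hy | apply Nat.eqb_refl].
  - simpl. apply par_false_in. intros x Hx. destruct (surj L x) eqn:E; [|reflexivity].
    rewrite surj_spec in E. apply dels_incl in Hx.
    assert (surj L l = true); [|congruence]. apply surj_spec.
    intros y Hy. auto.
Qed.

(** The Leibniz rule, for a front face of [a + 1] entries and the back face that starts at its last
    entry. Both terms on the right contain [alpha (firstn (S a) l) && beta (skipn (S a) l)], and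
    these two copies cancel. *)
Lemma cup_leibniz {A} (a : nat) (alpha beta : list A -> bool) l :
  (a + 2 <= length l)%nat ->
  par (fun m => alpha (firstn (S a) m) && beta (skipn a m)) (dels l) =
  xorb (par alpha (dels (firstn (S (S a)) l)) && beta (skipn (S a) l))
       (alpha (firstn (S a) l) && par beta (dels (skipn a l))).
Proof.
  revert alpha l. induction a as [|a IH]; intros alpha l Hl.
  - destruct l as [|x [|y l]]; simpl in Hl; try lia. simpl.
    rewrite !par_map. simpl.
    rewrite (par_andl (fun z => beta (x :: y :: z))).
    destruct (alpha [x]), (alpha [y]), (beta (y :: l)), (beta (x :: l)),
      (par (fun z => beta (x :: y :: z)) (dels l)); reflexivity.
  - destruct l as [|x l]; simpl in Hl; [lia|].
    specialize (IH (fun m => alpha (x :: m)) l ltac:(lia)).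
    change (dels (x :: l)) with (l :: map (cons x) (dels l)).
    change (firstn (S (S (S a))) (x :: l)) with (x :: firstn (S (S a)) l).
    change (dels (x :: firstn (S (S a)) l)) with
      (firstn (S (S a)) l :: map (cons x) (dels (firstn (S (S a)) l))).
    change (par ?f (?u :: ?v)) with (xorb (f u) (par f v)). cbv beta.
    rewrite !par_map.
    change (skipn (S (S a)) (x :: l)) with (skipn (S a) l).
    change (skipn (S a) (x :: l)) with (skipn a l).
    change (firstn (S (S a)) (x :: l)) with (x :: firstn (S a) l).
    change (par (fun m => alpha (firstn (S (S a)) (x :: m)) && beta (skipn (S a) (x :: m))) (dels l))
      with (par (fun m => alpha (x :: firstn (S a) m) && beta (skipn a m)) (dels l)).
    rewrite IH.
    destruct (alpha (firstn (S (S a)) l)), (beta (skipn (S a) l)),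
     (par (fun y => alpha (x :: y)) (dels (firstn (S (S a)) l))),
     (alpha (x :: firstn (S a) l)), (par beta (dels (skipn a l))); reflexivity.
Qed.

(* The cup product of the cochains [surj L_i], each pulled back along the
   [i]-th coordinate [lab i] of the labels. *)
Fixpoint cup (lab : nat -> nat -> nat) (i : nat) (I : list (list nat)) (l : list nat) : bool :=
  match I with
  | [] => Nat.eqb (length l) 1
  | L :: I' =>
      surj L (map (lab i) (firstn (S (pred (length L))) l)) &&
      cup lab (S i) I' (skipn (pred (length L)) l)
  end.

(** Sperner's boundary condition; [i] is the number of the first factor, since [cup] strips the
    factors one by one. *)
Definition labelled (lab : nat -> nat -> nat) (i : nat) (I : list (list nat)) (l : list nat) : Prop :=
  forall v j, In v l -> (j < length I)%nat -> In (lab (i + j)%nat v) (nth j I []).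

Lemma labelled_cons (lab : nat -> nat -> nat) i L I l :
  labelled lab i (L :: I) l <->
  (forall v, In v l -> In (lab i v) L) /\ labelled lab (S i) I l.
Proof.
  split.
  - intros H. split.
    + intros v Hv. specialize (H v 0%nat Hv). simpl in H. rewrite Nat.add_0_r in H.
      apply H. lia.
    + intros v j Hv Hj. specialize (H v (S j) Hv). simpl in H.
      rewrite Nat.add_succ_r in H. apply H. lia.
  - intros [H1 H2] v [|j] Hv Hj; simpl in *.
    + rewrite Nat.add_0_r. auto.
    + rewrite Nat.add_succ_r. apply H2; [assumption|lia].
Qed.

Lemma labelled_incl (lab : nat -> nat -> nat) i I l l' : incl l' l -> labelled lab i I l -> labelled lab i I l'.
Proof. intros H H' v j Hv. apply H'. auto. Qed.

Lemma incl_firstn {A} n (l : list A) : incl (firstn n l) l.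
Proof. intros x Hx. rewrite <- (firstn_skipn n l). apply in_app_iff. now left. Qed.

Lemma incl_skipn {A} n (l : list A) : incl (skipn n l) l.
Proof. intros x Hx. rewrite <- (firstn_skipn n l). apply in_app_iff. now right. Qed.

Lemma par_surj_lab_dels (lab : nat -> nat -> nat) i L l :
  NoDup L -> length l = S (length L) -> (forall v, In v l -> In (lab i v) L) ->
  par (fun m => surj L (map (lab i) m)) (dels l) = false.
Proof.
  intros N Hl H. rewrite <- (par_map (surj L) (map (lab i))), <- dels_map.
  rewrite par_surj_dels; [|assumption|now rewrite length_map].
  rewrite outside_false; [apply andb_false_r|].
  intros x Hx. apply in_map_iff in Hx as [v [<- Hv]]. auto.
Qed.

(** By the Leibniz rule, since each factor is a cocycle on tuples labelled within its simplex: no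
    label can lie outside [L]. *)
Lemma cup_closed (lab : nat -> nat -> nat) i I l :
  face I -> length l = S (S (dim I)) -> labelled lab i I l ->
  par (cup lab i I) (dels l) = false.
Proof.
  revert i l. induction I as [|L I IH]; intros i l F Hl Hlab.
  - simpl in *. destruct l as [|x [|y [|z l]]]; try discriminate. reflexivity.
  - inversion F as [|? ? [H1 H2] HF]; subst. simpl in Hl.
    apply labelled_cons in Hlab as [Hl1 Hl2].
    simpl cup.
    rewrite (cup_leibniz (pred (length L)) (fun m => surj L (map (lab i) m)) (cup lab (S i) I)) by lia.
    assert (Lp : length L = S (pred (length L))) by (destruct L; [congruence|reflexivity]).
    rewrite par_surj_lab_dels; [|assumption| |].
    + rewrite IH; [simpl; apply andb_false_r|assumption| |].
      * rewrite length_skipn. lia.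
      * eapply labelled_incl; [|exact Hl2]. apply incl_skipn.
    + rewrite length_firstn. lia.
    + intros v Hv. apply Hl1. eapply incl_firstn, Hv.
Qed.

(** The inductive step of Sperner's lemma in cochain form. The other factors are cocycles, and in
    the factor [b :: L] a label outside [L] can only be [b], so the coboundary of the cochain of the
    facet is the cochain of the face. *)
Lemma cup_shrink (lab : nat -> nat -> nat) i pre b L post l :
  L <> [] -> face (pre ++ (b :: L) :: post) ->
  length l = S (dim (pre ++ (b :: L) :: post)) ->
  labelled lab i (pre ++ (b :: L) :: post) l ->
  par (cup lab i (pre ++ L :: post)) (dels l) = cup lab i (pre ++ (b :: L) :: post) l.
Proof.
  intros HL. revert i l. induction pre as [|M pre IH]; intros i l F Hl Hlab; simpl app in *.
  - inversion F as [|? ? [H1 H2] HF]; subst. simpl in Hl.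
    apply labelled_cons in Hlab as [Hl1 Hl2].
    assert (Lp : length L = S (pred (length L))) by (destruct L; [congruence|reflexivity]).
    cbn [cup].
    rewrite (cup_leibniz (pred (length L)) (fun m => surj L (map (lab i) m)) (cup lab (S i) post)) by lia.
    rewrite cup_closed; [|assumption| |].
    2: { rewrite length_skipn. lia. }
    2: { eapply labelled_incl; [|exact Hl2]. apply incl_skipn. }
    rewrite andb_false_r, xorb_false_r. simpl length. simpl pred. rewrite <- Lp. f_equal.
    set (f := firstn (S (length L)) l).
    rewrite <- (par_map (surj L) (map (lab i))), <- dels_map.
    inversion H2; subst.
    rewrite par_surj_dels; [|assumption|].
    2: { unfold f. rewrite length_map, length_firstn. lia. }
    apply eq_true_iff_eq. rewrite andb_true_iff, !surj_spec. split.
    + intros [S O] x [<-|Hx]; [|auto].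
      apply existsb_exists in O as [e [He O]].
      assert (In e (b :: L)) as [<-|He'].
      { apply in_map_iff in He as [v [<- Hv]]. apply Hl1. eapply incl_firstn, Hv. }
      * exact He.
      * exfalso. apply negb_true_iff in O.
        assert (existsb (Nat.eqb e) L = true); [|congruence].
        apply existsb_exists. exists e. split; [exact He' | apply Nat.eqb_refl].
    + intros S. split; [intros x Hx; apply S; now right|].
      apply existsb_exists. exists b. split; [apply S; now left|].
      apply negb_true_iff. destruct (existsb (Nat.eqb b) L) eqn:E; [|reflexivity].
      apply existsb_exists in E as [e [He E]]. apply Nat.eqb_eq in E. now subst.
  - inversion F as [|? ? [H1 H2] HF]; subst. simpl in Hl.
    apply labelled_cons in Hlab as [Hl1 Hl2].
    assert (Lp : length M = S (pred (length M))) by (destruct M; [congruence|reflexivity]).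
    assert (Ld : (1 <= dim (pre ++ (b :: L) :: post))%nat).
    { clear - HL. induction pre; simpl; [destruct L; [congruence|simpl; lia]|lia]. }
    cbn [cup].
    rewrite (cup_leibniz (pred (length M)) (fun m => surj M (map (lab i) m))
      (cup lab (S i) (pre ++ L :: post))) by lia.
    rewrite par_surj_lab_dels; [|assumption| |].
    + rewrite IH; [reflexivity|assumption| |].
      * rewrite length_skipn. lia.
      * eapply labelled_incl; [|exact Hl2]. apply incl_skipn.
    + rewrite length_firstn. lia.
    + intros v Hv. apply Hl1. eapply incl_firstn, Hv.
Qed.

Lemma cup_missing (lab : nat -> nat -> nat) i I l j e :
  In e (nth j I []) -> (forall v, In v l -> lab (i + j)%nat v <> e) -> cup lab i I l = false.
Proof.
  revert i j l. induction I as [|L I IH]; intros i j l He H.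
  - destruct j; contradiction.
  - cbn [cup]. destruct j as [|j]; simpl in He.
    + destruct (surj L _) eqn:E; [|reflexivity]. rewrite surj_spec in E.
      apply E in He. apply in_map_iff in He as [v [Hv Hv']].
      exfalso. apply (H v); [eapply incl_firstn, Hv'|]. now rewrite Nat.add_0_r.
    + rewrite (IH (S i) j); [apply andb_false_r|assumption|].
      intros v Hv. rewrite Nat.add_succ_comm. apply H. eapply incl_skipn, Hv.
Qed.

(** * Sorting the labels *)

Fixpoint insert (x : nat) (l : list nat) : list nat :=
  match l with
  | [] => [x]
  | y :: l' => if Nat.leb x y then x :: l else y :: insert x l'
  end.

(** The cup product depends on the order of the vertices. A fixed order of the labels makes it a
    function of their multiset and brings equal labels together. *)
Definition isort (l : list nat) : list nat := fold_right insert [] l.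

Lemma insert_perm x l : Permutation (insert x l) (x :: l).
Proof.
  induction l as [|y l IH]; simpl; [apply Permutation_refl|].
  destruct (Nat.leb x y); [apply Permutation_refl|].
  rewrite IH. constructor.
Qed.

Lemma isort_perm l : Permutation (isort l) l.
Proof.
  induction l; simpl; [constructor|]. rewrite insert_perm. now constructor.
Qed.

Lemma insert_sorted x l : StronglySorted le l -> StronglySorted le (insert x l).
Proof.
  induction 1 as [|y l H IH Hy]; simpl; [repeat constructor|].
  destruct (Nat.leb_spec x y).
  - constructor; [now constructor|]. constructor; [assumption|].
    eapply Forall_impl; [|exact Hy]. simpl. lia.
  - constructor; [assumption|].
    rewrite Forall_forall in *. intros z Hz.
    apply (Permutation_in _ (insert_perm x l)) in Hz as [<-|Hz]; [lia|auto].
Qed.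

Lemma isort_sorted l : StronglySorted le (isort l).
Proof. induction l; simpl; [constructor | now apply insert_sorted]. Qed.

Lemma sorted_perm_eq l l' :
  StronglySorted le l -> StronglySorted le l' -> Permutation l l' -> l = l'.
Proof.
  intros H. revert l'. induction H as [|x l H IH Hx]; intros l' H' P.
  - now apply Permutation_nil in P.
  - destruct H' as [|y l' H' Hy]; [symmetry in P; now apply Permutation_nil in P|].
    rewrite Forall_forall in *.
    assert (x = y).
    { assert (A : In x (y :: l')) by (apply (Permutation_in _ P); now left).
      assert (B : In y (x :: l)) by (apply (Permutation_in _ (Permutation_sym P)); now left).
      destruct A as [A|A]; [auto|]. destruct B as [B|B]; [auto|].
      apply Hx in B. apply Hy in A. lia. }
    subst. f_equal. apply IH; [assumption|]. now apply Permutation_cons_inv in P.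
Qed.

Lemma isort_eq l l' : Permutation l l' -> isort l = isort l'.
Proof.
  intros P. apply sorted_perm_eq; [apply isort_sorted..|]. now rewrite !isort_perm.
Qed.

Lemma dels_sorted l m : StronglySorted le l -> In m (dels l) -> StronglySorted le m.
Proof.
  intros H. revert m. induction H as [|x l H IH Hx]; simpl; intros m Hm; [contradiction|].
  destruct Hm as [<-|Hm]; [assumption|].
  apply in_map_iff in Hm as [y [<- Hy]]. constructor; [auto|].
  rewrite Forall_forall in *. intros z Hz. apply Hx. now apply (dels_incl l y).
Qed.

Lemma par_isort_dels (f : list nat -> bool) l :
  par (fun m => f (isort m)) (dels l) = par f (dels (isort l)).
Proof.
  rewrite (par_dels_perm _ l (isort l)).
  - apply par_ext_in. intros m Hm. f_equal. apply sorted_perm_eq.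
    + apply isort_sorted.
    + eapply dels_sorted; [apply isort_sorted | exact Hm].
    + apply isort_perm.
  - symmetry. apply isort_perm.
  - intros m m' P. f_equal. now apply isort_eq.
Qed.

(** The two parts share the entry at position [a]. In a sorted list, equal entries on either side of
    it force it to be equal to them as well, which the front part forbids. *)
Lemma sorted_NoDup_glue a l :
  StronglySorted le l -> (a < length l)%nat ->
  NoDup (firstn (S a) l) -> NoDup (skipn a l) -> NoDup l.
Proof.
  revert l. induction a as [|a IH]; intros l S Hl H1 H2; [assumption|].
  destruct l as [|x l]; [simpl in Hl; lia|]. simpl in Hl.
  inversion S as [|? ? S1 Sx]; subst.
  change (NoDup (x :: firstn (Datatypes.S a) l)) in H1. inversion H1 as [|? ? N1 N2]; subst.
  constructor; [|apply IH; auto; lia].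
  intros Hin. rewrite <- (firstn_skipn (Datatypes.S a) l) in Hin.
  apply in_app_iff in Hin as [Hin|Hin]; [contradiction|].
  assert (E : exists y, In y (firstn (Datatypes.S a) l) /\ (y <= x)%nat).
  { assert (Hs : skipn a l <> []).
    { intros E. apply (f_equal (@length nat)) in E. rewrite length_skipn in E. simpl in E. lia. }
    destruct (skipn a l) as [|y r] eqn:E; [congruence|].
    exists y. split.
    - clear - E. revert l E. induction a; intros l E.
      + simpl in E. subst. now left.
      + destruct l as [|z l]; [discriminate|]. simpl in E. right.
        exact (IHa l E).
    - assert (E2 : skipn (Datatypes.S a) l = r).
      { clear - E. revert l E. induction a; intros l E.
        - simpl in E. now subst.
        - destruct l as [|z l]; [discriminate|]. simpl in E. exact (IHa l E). }
      rewrite E2 in Hin.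
      assert (S2 : StronglySorted le (y :: r)).
      { rewrite <- E. clear - S1. revert l S1. induction a; intros l S1; [exact S1|].
        destruct l; [constructor|]. simpl. inversion S1; auto. }
      inversion S2 as [|? ? ? F]; subst. rewrite Forall_forall in F. auto. }
  destruct E as [y [Hy Hle]]. rewrite Forall_forall in Sx.
  assert (x <= y)%nat by (apply Sx; eapply incl_firstn, Hy).
  assert (x = y) by lia. subst. contradiction.
Qed.

(** A list of [length L] entries whose labels cover [L] has distinct labels, hence distinct entries.
    This applies to each front part, and the parts are glued along the shared vertices. *)
Lemma cup_NoDup (lab : nat -> nat -> nat) i I l :
  face I -> StronglySorted le l -> length l = S (dim I) -> cup lab i I l = true -> NoDup l.
Proof.
  revert i l. induction I as [|L I IH]; intros i l F S Hl H.
  - simpl in *. destruct l as [|x [|y l]]; try discriminate. repeat constructor. auto.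
  - inversion F as [|? ? [H1 H2] HF]; subst. simpl in Hl. cbn [cup] in H.
    apply andb_true_iff in H as [Ha Hb].
    assert (Lp : length L = Datatypes.S (pred (length L))) by (destruct L; [congruence|reflexivity]).
    apply (sorted_NoDup_glue (pred (length L))); [assumption|lia| |].
    + apply surj_spec in Ha.
      apply (NoDup_map_inv (lab i)).
      apply (NoDup_incl_NoDup H2); [|exact Ha].
      rewrite length_map, length_firstn. lia.
    + apply (IH (Datatypes.S i)); [assumption| |rewrite length_skipn; lia|assumption].
      clear - S. revert l S. induction (pred (length L)); intros l S; [exact S|].
      destruct l; [constructor|]. simpl. inversion S; auto.
Qed.

(** * Complete CAT(0) spaces *)

Section CompleteCAT0.

Context {X : Type} (dist : X -> X -> R)
  (Hmet : is_metric dist) (Hcomp : complete dist) (Hcat : CAT0 dist).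

Lemma dist_refl x : dist x x = 0.
Proof. destruct Hmet as [H _]. now apply H. Qed.

Lemma dist_eq x y : dist x y = 0 -> x = y.
Proof. destruct Hmet as [H _]. apply H. Qed.

Lemma dist_sym x y : dist x y = dist y x.
Proof. destruct Hmet as [_ [H _]]. apply H. Qed.

Lemma dist_tri x y z : dist x z <= dist x y + dist y z.
Proof. destruct Hmet as [_ [_ H]]. apply H. Qed.

Lemma dist_nonneg x y : 0 <= dist x y.
Proof.
  pose proof (dist_tri x y x). rewrite dist_refl, (dist_sym y x) in H. lra.
Qed.

(** The comparison triangle with vertices [x], [y], [y] is degenerate, and both points lie at the
    same place on it. *)
Lemma geodesic_unique x y c1 c2 s :
  geodesic dist x y c1 -> geodesic dist x y c2 -> 0 <= s <= dist x y -> c1 s = c2 s.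
Proof.
  intros G1 G2 Hs. apply dist_eq.
  destruct Hcat as [_ HC].
  specialize (HC x y y c1 c2 G1 G2 s s Hs Hs). simpl in HC.
  rewrite dist_refl in HC. pose proof (dist_nonneg (c1 s) (c2 s)) as Hp.
  (* The comparison formula divides by side lengths, so sides of length 0 are treated separately,
     here and below. *)
  destruct (Req_dec (dist x y) 0) as [E|E].
  - assert (s = 0) by lra. subst s. rewrite E in HC.
    unfold Rdiv in HC. rewrite !Rmult_0_l in HC. nra.
  - assert (s * (s * 1) + s * (s * 1) - s * s * (dist x y * (dist x y * 1) + dist x y * (dist x y * 1) - 0 * (0 * 1)) / (dist x y * dist x y) = 0)
      by (field; exact E).
    nra.
Qed.

(** * Contraction along geodesics *)

Definition geo (x y : X) : R -> X :=
  epsilon (inhabits (fun _ => x)) (geodesic dist x y).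

Lemma geo_spec x y : geodesic dist x y (geo x y).
Proof. unfold geo. apply epsilon_spec. destruct Hcat as [H _]. apply H. Qed.

(** The time [t] is the proportion of the way to [p] already covered: time 0 is the identity and
    time 1 the constant map. *)
Definition contract (p : X) (t : R) (x : X) : X := geo p x ((1 - t) * dist p x).

Lemma contract_range p t x : 0 <= t <= 1 -> 0 <= (1 - t) * dist p x <= dist p x.
Proof. intros H. pose proof (dist_nonneg p x). nra. Qed.

Lemma contract_0 p x : contract p 0 x = x.
Proof.
  unfold contract. rewrite Rminus_0_r, Rmult_1_l. apply geo_spec.
Qed.

Lemma contract_1 p x : contract p 1 x = p.
Proof.
  unfold contract. replace ((1 - 1) * dist p x) with 0 by ring. apply geo_spec.
Qed.

Lemma contract_time p s t x :
  0 <= s <= 1 -> 0 <= t <= 1 ->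
  dist (contract p s x) (contract p t x) = Rabs (s - t) * dist p x.
Proof.
  intros Hs Ht. unfold contract.
  destruct (geo_spec p x) as [_ [_ H]].
  rewrite H by now apply contract_range.
  replace ((1 - s) * dist p x - (1 - t) * dist p x) with ((t - s) * dist p x) by ring.
  rewrite Rabs_mult, (Rabs_right (dist p x)) by (apply Rle_ge, dist_nonneg).
  now rewrite Rabs_minus_sym.
Qed.

(** In the comparison triangle both points divide their sides in the same ratio, so similarity gives
    even the factor [1 - t]. *)
Lemma contract_lip p t x y :
  0 <= t <= 1 -> dist (contract p t x) (contract p t y) <= dist x y.
Proof.
  intros Ht. unfold contract.
  pose proof (dist_nonneg x y) as Hxy. pose proof (dist_nonneg p x) as Hx.
  pose proof (dist_nonneg p y) as Hy.
  pose proof (contract_range p t x Ht) as Rx. pose proof (contract_range p t y Ht) as Ry.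
  destruct Hcat as [_ HC].
  specialize (HC p x y _ _ (geo_spec p x) (geo_spec p y) _ _ Rx Ry). simpl in HC.
  set (D := dist (geo p x _) (geo p y _)) in *.
  assert (HD : 0 <= D) by apply dist_nonneg.
  assert (D * D <= (1 - t) * (1 - t) * (dist x y * dist x y)).
  { destruct (Req_dec (dist p x) 0) as [E|E].
    - assert (p = x) by now apply dist_eq. subst x. rewrite E in HC. unfold Rdiv in HC.
      rewrite !Rmult_0_r, !Rmult_0_l in HC. nra.
    - destruct (Req_dec (dist p y) 0) as [E'|E'].
      + assert (p = y) by now apply dist_eq. subst y. rewrite E' in HC. unfold Rdiv in HC.
        rewrite (dist_sym x p). rewrite !Rmult_0_r, !Rmult_0_l in HC. nra.
      + eapply Rle_trans; [|eapply Rle_trans; [exact HC|]]; [nra|].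
        right. field. split; assumption. }
  assert (D * D <= dist x y * dist x y).
  { assert ((1 - t) * (1 - t) <= 1) by nra.
    assert (0 <= dist x y * dist x y) by nra. nra. }
  nra.
Qed.

Definition convex (C : X -> Prop) : Prop :=
  forall x y c s, C x -> C y -> geodesic dist x y c -> 0 <= s <= dist x y -> C (c s).

Definition closed (C : X -> Prop) : Prop :=
  forall x, (forall e, 0 < e -> exists y, C y /\ dist x y < e) -> C x.

Lemma closed_compl_open C : closed C -> is_open dist (fun x => ~ C x).
Proof.
  intros HC x Hx. apply NNPP. intros H. apply Hx, HC. intros e He.
  apply NNPP. intros H'. apply H. exists e. split; [assumption|].
  intros y Hy HCy. apply H'. now exists y.
Qed.

Lemma contract_convex C p t x :
  convex C -> C p -> C x -> 0 <= t <= 1 -> C (contract p t x).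
Proof.
  intros HC Hp Hx Ht. unfold contract. eapply HC; [exact Hp|exact Hx|apply geo_spec|].
  now apply contract_range.
Qed.

Lemma convex_all : convex (fun _ => True).
Proof. repeat intro. exact I. Qed.

Lemma closed_all : closed (fun _ => True).
Proof. repeat intro. exact I. Qed.

(* The CN inequality of Bruhat and Tits. *)
Lemma midpoint y z :
  exists m, (forall C, convex C -> C y -> C z -> C m) /\
    forall x, dist x m * dist x m <=
      (dist x y * dist x y + dist x z * dist x z) / 2 - dist y z * dist y z / 4.
Proof.
  assert (Hr : 0 <= dist y z / 2 <= dist y z) by (pose proof (dist_nonneg y z); lra).
  exists (geo y z (dist y z / 2)). split.
  - intros C HC Hy Hz. eapply HC; [exact Hy|exact Hz|apply geo_spec|assumption].
  - intros x.
    pose proof (geo_spec y x) as Gx. pose proof (geo_spec y z) as Gz.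
    assert (Hx : 0 <= dist y x <= dist y x) by (pose proof (dist_nonneg y x); lra).
    destruct Hcat as [_ HC].
    specialize (HC y z x _ _ Gz Gx _ _ Hr Hx). simpl in HC.
    destruct Gx as [_ [Ex _]]. rewrite Ex in HC.
    set (m := geo y z (dist y z / 2)) in *.
    rewrite (dist_sym x m), (dist_sym x y), (dist_sym x z).
    destruct (Req_dec (dist y z) 0) as [E|E].
    + assert (Hzx : dist z x = dist y x) by (apply dist_eq in E; now rewrite E).
      rewrite E in HC. unfold Rdiv in HC. rewrite !Rmult_0_l in HC.
      rewrite E, Hzx. nra.
    + destruct (Req_dec (dist y x) 0) as [E'|E'].
      * assert (Hzx : dist z x = dist y z) by (apply dist_eq in E'; subst; apply dist_sym).
        rewrite E' in HC. unfold Rdiv in HC. rewrite ?Rmult_0_r, ?Rmult_0_l in HC.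
        rewrite E', Hzx. nra.
      * replace (dist m x * dist m x) with (dist m x * (dist m x * 1)) by ring.
        eapply Rle_trans; [exact HC|]. right. rewrite (dist_sym z x). field. split; assumption.
Qed.

Lemma Rinv_INR_pos n : 0 < / INR (S n).
Proof. apply Rinv_0_lt_compat, lt_0_INR. lia. Qed.

Lemma small_inv e : 0 < e -> exists N, forall n, (N <= n)%nat -> / INR (S n) < e.
Proof.
  intros He. destruct (archimed_cor1 e He) as [N [HN HN']]. exists N. intros n Hn.
  eapply Rle_lt_trans; [|exact HN]. apply Rinv_le_contravar.
  - now apply lt_0_INR.
  - apply le_INR. lia.
Qed.

(* The Chebyshev centre of [S] relative to [C]. It gives the projection
   of [s] to [C] when [S] is [{s}], and the Bruhat-Tits theorem when [C] is everything. *)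
Lemma relative_centre (C S : X -> Prop) (o : X) (B : R) :
  closed C -> convex C -> (exists x, C x) -> S o -> (forall s, S s -> dist o s <= B) ->
  exists c, C c /\ forall g : X -> X,
    (forall x y, dist (g x) (g y) = dist x y) ->
    (forall s, S s -> exists s', S s' /\ g s' = s) ->
    (forall x, C x -> C (g x)) -> g c = c.
Proof.
  intros Hcl Hcv [x0 Hx0] Ho HB.
  set (bd := fun x r => C x /\ forall s, S s -> dist x s * dist x s <= r).
  assert (Hinf : exists r0, (forall x r, bd x r -> r0 <= r) /\
     forall e, 0 < e -> exists x, bd x (r0 + e)).
  { set (E := fun r => exists x, bd x (- r)).
    destruct (completeness E) as [m [Hm1 Hm2]].
    - exists 0. intros r [x [_ Hx]]. specialize (Hx o Ho). nra.
    - exists (- ((dist x0 o + B) * (dist x0 o + B))). exists x0. split; [assumption|].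
      intros s Hs. rewrite Ropp_involutive.
      pose proof (dist_tri x0 o s). pose proof (HB s Hs).
      pose proof (dist_nonneg x0 s). nra.
    - exists (- m). split.
      + intros x r Hx. assert (E (- r)) by (exists x; now rewrite Ropp_involutive).
        apply Hm1 in H. lra.
      + intros e He. apply NNPP. intros H.
        assert (m <= m - e); [|lra]. apply Hm2. intros r [x Hx].
        apply Rnot_lt_le. intros Hr. apply H. exists x. destruct Hx as [Hx1 Hx2].
        split; [assumption|]. intros s Hs. specialize (Hx2 s Hs). lra. }
  destruct Hinf as [r0 [Hr1 Hr2]].
  (* If two points nearly attain the infimum, their midpoint would beat it unless they are close.
     This makes minimising sequences Cauchy and the centre unique. *)
  assert (Huniq : forall x y e, bd x (r0 + e) -> bd y (r0 + e) -> dist x y * dist x y <= 4 * e).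
  { intros x y e [Hx1 Hx2] [Hy1 Hy2]. destruct (midpoint x y) as [m [Hm1 Hm2]].
    assert (r0 <= r0 + e - dist x y * dist x y / 4); [|lra].
    apply (Hr1 m). split; [now apply Hm1|].
    intros s Hs. specialize (Hm2 s). specialize (Hx2 s Hs). specialize (Hy2 s Hs).
    rewrite (dist_sym m s). rewrite (dist_sym s x), (dist_sym s y) in Hm2. lra. }
  assert (Hmono : forall x e e', bd x (r0 + e) -> e <= e' -> bd x (r0 + e')).
  { intros x e e' [H1 H2] He. split; [assumption|]. intros s Hs. specialize (H2 s Hs). lra. }
  set (u := fun n => epsilon (inhabits x0) (fun x => bd x (r0 + / INR (Datatypes.S n)))).
  assert (Hu : forall n, bd (u n) (r0 + / INR (Datatypes.S n))).
  { intros n. unfold u. apply epsilon_spec, Hr2, Rinv_INR_pos. }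
  destruct (Hcomp u) as [c Hc].
  { intros e He. destruct (small_inv (e * e / 8)) as [N HN]; [nra|].
    exists N. intros p q Hp Hq.
    assert (A : dist (u p) (u q) * dist (u p) (u q) <= 4 * (e * e / 8)).
    { apply Huniq; eapply Hmono; try apply Hu; left; now apply HN. }
    pose proof (dist_nonneg (u p) (u q)). nra. }
  assert (Cc : C c).
  { apply Hcl. intros e He. destruct (Hc e He) as [N HN]. exists (u N).
    split; [apply Hu|]. rewrite dist_sym. now apply HN. }
  assert (Hbc : bd c r0).
  { split; [assumption|]. intros s Hs. apply Rnot_lt_le. intros Hlt.
    set (d := dist c s * dist c s - r0). set (M := dist c s + 1).
    assert (HM : 1 <= M) by (unfold M; pose proof (dist_nonneg c s); lra).
    assert (Hd : 0 < d) by (unfold d; lra).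
    (* [eta] is so small that moving a point by [eta] raises a squared distance of at most [M^2] by
       at most [d / 4]. *)
    set (eta := Rmin 1 (d / (4 * (2 * M + 1)))).
    assert (Heta : 0 < eta).
    { unfold eta. apply Rmin_glb_lt; [lra|]. apply Rdiv_lt_0_compat; lra. }
    assert (Heta1 : eta <= 1) by apply Rmin_l.
    assert (Heta2 : eta * (2 * M + 1) <= d / 4).
    { apply Rle_trans with (d / (4 * (2 * M + 1)) * (2 * M + 1)).
      - apply Rmult_le_compat_r; [lra|apply Rmin_r].
      - right. field. lra. }
    destruct (small_inv (d / 4)) as [N1 HN1]; [lra|].
    destruct (Hc eta Heta) as [N2 HN2].
    set (n := (N1 + N2)%nat).
    destruct (Hu n) as [_ Hn]. specialize (Hn s Hs).
    specialize (HN1 n ltac:(unfold n; lia)). specialize (HN2 n ltac:(unfold n; lia)).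
    pose proof (dist_tri c (u n) s) as T1. pose proof (dist_tri (u n) c s) as T2.
    rewrite (dist_sym c (u n)) in T1.
    pose proof (dist_nonneg (u n) s) as P1. pose proof (dist_nonneg c s) as P2.
    pose proof (dist_nonneg (u n) c) as P3.
    assert (dist (u n) s <= M) by (unfold M; lra).
    assert (dist c s * dist c s <= dist (u n) s * dist (u n) s + eta * (2 * M + 1)).
    { assert (dist c s <= dist (u n) s + eta) by lra. nra. }
    unfold d in *. lra. }
  exists c. split; [assumption|]. intros g Hg HgS HgC.
  apply dist_eq.
  assert (Hgc : bd (g c) r0).
  { split; [now apply HgC|]. intros s Hs. destruct (HgS s Hs) as [s' [Hs' <-]].
    rewrite Hg. now apply Hbc. }
  assert (dist (g c) c * dist (g c) c <= 4 * 0)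
    by (apply Huniq; rewrite Rplus_0_r; assumption).
  nra.
Qed.

(** * Fixed-point sets of isometries *)

Lemma fix_closed (g : X -> X) :
  (forall x y, dist (g x) (g y) = dist x y) -> closed (fun x => g x = x).
Proof.
  intros Hg x Hx. apply dist_eq. apply Rle_antisym; [|apply dist_nonneg].
  apply Rnot_lt_le. intros H. destruct (Hx (dist (g x) x / 2)) as [y [Hy Hd]]; [lra|].
  pose proof (dist_tri (g x) (g y) x). rewrite Hg, Hy, (dist_sym y x) in H0. lra.
Qed.

(** An isometry carries a geodesic between two fixed points to a geodesic with the same end points,
    which by uniqueness is the same one. *)
Lemma fix_convex (g : X -> X) :
  (forall x y, dist (g x) (g y) = dist x y) -> convex (fun x => g x = x).
Proof.
  intros Hg x y c s Hx Hy G Hs.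
  apply (geodesic_unique x y (fun r => g (c r)) c s); [|assumption..].
  destruct G as [G1 [G2 G3]]. split; [now rewrite G1|]. split; [now rewrite G2|].
  intros. rewrite Hg. now apply G3.
Qed.

Lemma closed_forall {I : Type} (P : I -> Prop) (C : I -> X -> Prop) :
  (forall i, P i -> closed (C i)) -> closed (fun x => forall i, P i -> C i x).
Proof.
  intros H x Hx i Hi. apply H; [assumption|]. intros e He.
  destruct (Hx e He) as [y [Hy Hd]]. exists y; auto.
Qed.

Lemma convex_forall {I : Type} (P : I -> Prop) (C : I -> X -> Prop) :
  (forall i, P i -> convex (C i)) -> convex (fun x => forall i, P i -> C i x).
Proof.
  intros H x y c s Hx Hy G Hs i Hi. apply (H i Hi x y); auto.
Qed.

(** [B] preserves the fixed-point set of [A] because it commutes with [A]; hence the projection to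
    that set of a point fixed by [B] is again fixed by [B]. *)
Lemma commuting_fixed_point (A B : (X -> X) -> Prop) :
  (forall a, A a -> forall x y, dist (a x) (a y) = dist x y) ->
  (forall b, B b -> forall x y, dist (b x) (b y) = dist x y) ->
  (forall a b x, A a -> B b -> a (b x) = b (a x)) ->
  (exists x, forall a, A a -> a x = x) -> (exists x, forall b, B b -> b x = x) ->
  exists x, (forall a, A a -> a x = x) /\ (forall b, B b -> b x = x).
Proof.
  intros HA HB Hc [a0 Ha0] [b0 Hb0].
  destruct (relative_centre (fun x => forall a, A a -> a x = x) (fun s => s = b0) b0 0)
    as [c [Hc1 Hc2]].
  - apply closed_forall. intros. apply fix_closed. auto.
  - apply convex_forall. intros. apply fix_convex. auto.
  - now exists a0.
  - reflexivity.
  - intros s ->. rewrite dist_refl. lra.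
  - exists c. split; [assumption|]. intros b Hb. apply Hc2; [auto| |].
    + intros s ->. exists b0. split; auto.
    + intros x Hx a Ha. rewrite Hc by assumption. now rewrite Hx.
Qed.

(** * Totally bounded subsets *)

(** In a complete space this is enough for a Lebesgue number, so the coned simplices need not be
    shown compact. Centres outside [K] are allowed. *)
Definition totally_bounded (K : X -> Prop) : Prop :=
  forall e, 0 < e -> exists l, forall x, K x -> exists y, In y l /\ dist x y < e.

Lemma totally_bounded_bounded K p :
  totally_bounded K -> exists D, forall x, K x -> dist p x <= D.
Proof.
  intros H. destruct (H 1 ltac:(lra)) as [l Hl].
  assert (E : exists D, forall y, In y l -> dist p y <= D).
  { clear. induction l as [|y l [D HD]].
    - exists 0. contradiction.
    - exists (Rmax (dist p y) D). intros z [<-|Hz]; [apply Rmax_l|].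
      eapply Rle_trans; [now apply HD|apply Rmax_r]. }
  destruct E as [D HD]. exists (D + 1). intros x Hx.
  destruct (Hl x Hx) as [y [Hy Hd]]. specialize (HD y Hy).
  pose proof (dist_tri p y x). rewrite (dist_sym y x) in H0. lra.
Qed.

Lemma totally_bounded_single p : totally_bounded (fun x => x = p).
Proof.
  intros e He. exists [p]. intros x ->. exists p. rewrite dist_refl. split; [now left|assumption].
Qed.

Lemma totally_bounded_union {I} (l : list I) (K : I -> X -> Prop) :
  (forall i, In i l -> totally_bounded (K i)) ->
  totally_bounded (fun x => exists i, In i l /\ K i x).
Proof.
  intros H e He. induction l as [|i l IH].
  - exists []. intros x [i [[] _]].
  - destruct IH as [l1 H1]; [intros; apply H; now right|].
    destruct (H i (or_introl eq_refl) e He) as [l2 H2].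
    exists (l1 ++ l2). intros x [j [[<-|Hj] Hx]].
    + destruct (H2 x Hx) as [y [Hy Hd]]. exists y. rewrite in_app_iff. auto.
    + destruct (H1 x) as [y [Hy Hd]]; [now exists j|]. exists y. rewrite in_app_iff. auto.
Qed.

(** Contraction is 1-Lipschitz in the point and, on a bounded set, Lipschitz in time; a net of [K]
    and a grid of times give a net of the cone. *)
Lemma totally_bounded_cone K p :
  totally_bounded K ->
  totally_bounded (fun x => exists y t, K y /\ 0 <= t <= 1 /\ x = contract p t y).
Proof.
  intros H e He. destruct (totally_bounded_bounded K p H) as [D HD].
  destruct (H (e / 2) ltac:(lra)) as [l Hl].
  destruct (small_inv (e / (2 * (Rabs D + 1)))) as [M HM].
  { apply Rdiv_lt_0_compat; [assumption|]. pose proof (Rabs_pos D). lra. }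
  specialize (HM M (le_n _)).
  exists (flat_map (fun y => map (fun j => contract p (INR j / INR (S M)) y) (seq 0 (S (S M)))) l).
  intros x (y & t & Hy & Ht & ->).
  destruct (Hl y Hy) as [z [Hz Hd]].
  assert (Hpos : 0 < INR (S M)) by (apply lt_0_INR; lia).
  assert (E : exists j, (j <= S M)%nat /\ Rabs (t - INR j / INR (S M)) <= / INR (S M)).
  { assert (G : forall w n, 0 <= w -> w <= INR n -> exists j, (j <= n)%nat /\ INR j - 1 <= w <= INR j).
    { clear. intros w n Hw. induction n; intros Hn.
      - exists 0%nat. split; [lia|]. simpl in *. lra.
      - destruct (Rle_lt_dec w (INR n)) as [L|L].
        + destruct (IHn L) as [j [Hj Hj']]. exists j. split; [lia|assumption].
        + exists (S n). split; [lia|]. rewrite S_INR in *. lra. }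
    destruct (G (t * INR (S M)) (S M)) as [j [Hj Hj']]; [nra..|]. exists j. split; [assumption|].
    replace (t - INR j / INR (S M)) with ((t * INR (S M) - INR j) * / INR (S M)) by (field; lra).
    rewrite Rabs_mult, (Rabs_right (/ _)) by (left; apply Rinv_INR_pos).
    rewrite <- (Rmult_1_l (/ INR (S M))) at 2. apply Rmult_le_compat_r.
    - left; apply Rinv_INR_pos.
    - apply Rabs_le. lra. }
  destruct E as [j [Hj Ej]].
  exists (contract p (INR j / INR (S M)) z). split.
  - apply in_flat_map. exists z. split; [assumption|]. apply in_map_iff.
    exists j. split; [reflexivity|]. apply in_seq. lia.
  - assert (Hjr : 0 <= INR j / INR (S M) <= 1).
    { split.
      - unfold Rdiv. apply Rmult_le_pos; [apply pos_INR|]. left. now apply Rinv_0_lt_compat.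
      - apply Rmult_le_reg_r with (INR (S M)); [assumption|].
        unfold Rdiv. rewrite Rmult_assoc, Rinv_l by lra.
        rewrite Rmult_1_r, Rmult_1_l. now apply le_INR. }
    pose proof (dist_tri (contract p t y) (contract p (INR j / INR (S M)) y)
      (contract p (INR j / INR (S M)) z)) as T.
    rewrite contract_time in T by assumption.
    pose proof (contract_lip p _ y z Hjr) as L.
    assert (Rabs (t - INR j / INR (S M)) * dist p y < e / 2); [|lra].
    pose proof (HD y Hy) as HDy. pose proof (dist_nonneg p y) as Hp.
    pose proof (Rle_abs D) as HDa. pose proof (Rabs_pos D) as HDp.
    apply Rle_lt_trans with (/ INR (S M) * (Rabs D + 1)).
    + apply Rmult_le_compat; [apply Rabs_pos|assumption|assumption|lra].
    + apply Rlt_le_trans with (e / (2 * (Rabs D + 1)) * (Rabs D + 1)).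
      * apply Rmult_lt_compat_r; lra.
      * right. field. lra.
Qed.

(* Total boundedness splits a set without a Lebesgue number into
   smaller and smaller such sets, which converge to a point. *)
Lemma lebesgue_number K (Us : (X -> Prop) -> Prop) :
  totally_bounded K ->
  (forall U, Us U -> is_open dist U) -> (forall x, exists U, Us U /\ U x) ->
  exists e, 0 < e /\ forall x, K x -> exists U, Us U /\ forall y, dist x y < e -> U y.
Proof.
  intros HK Hop Hcov.
  set (good := fun A : X -> Prop => exists e, 0 < e /\
    forall x, A x -> exists U, Us U /\ forall y, dist x y < e -> U y).
  change (good K). apply NNPP. intros HbadK.
  assert (o : inhabited X).
  { apply NNPP. intros H. apply HbadK. exists 1. split; [lra|].
    intros x. exfalso. apply H. constructor. exact x. }
  set (sub := fun (A : X -> Prop) y e x => A x /\ dist x y < e).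
  assert (Hstep : forall A e, (forall x, A x -> K x) -> ~ good A -> 0 < e ->
    exists y, ~ good (sub A y e)).
  { intros A e HA Hbad He. apply NNPP. intros H. apply Hbad.
    destruct (HK e He) as [l Hl].
    assert (G : exists d, 0 < d /\ forall x, A x -> (exists y, In y l /\ dist x y < e) ->
       exists U, Us U /\ forall y, dist x y < d -> U y).
    { clear Hl. induction l as [|y l [d [Hd IH]]].
      - exists 1. split; [lra|]. intros x _ [y [[] _]].
      - assert (Gy : good (sub A y e)) by (apply NNPP; intros H'; apply H; now exists y).
        destruct Gy as [d' [Hd' Gy]]. exists (Rmin d d').
        split; [now apply Rmin_glb_lt|]. intros x Hx [z [[<-|Hz] Hd2]].
        + destruct (Gy x (conj Hx Hd2)) as [U [HU HU']]. exists U. split; [assumption|].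
          intros w Hw. apply HU'. eapply Rlt_le_trans; [exact Hw|apply Rmin_r].
        + destruct (IH x Hx) as [U [HU HU']]; [now exists z|]. exists U. split; [assumption|].
          intros w Hw. apply HU'. eapply Rlt_le_trans; [exact Hw|apply Rmin_l]. }
    destruct G as [d [Hd G]]. exists d. split; [assumption|].
    intros x Hx. apply G; [assumption|]. apply Hl. now apply HA. }
  set (next := fun (n : nat) (A : X -> Prop) =>
    sub A (epsilon o (fun y => ~ good (sub A y (/ INR (S n))))) (/ INR (S n))).
  set (As := fix As n := match n with O => K | S m => next m (As m) end).
  assert (HAs : forall n, (forall x, As n x -> K x) /\ ~ good (As n)).
  { induction n as [|n [IH1 IH2]]; [split; [trivial|exact HbadK]|]. split.
    - intros x [Hx _]. now apply IH1.
    - simpl. unfold next. apply (epsilon_spec o (fun y => ~ good (sub (As n) y (/ INR (S n))))).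
      apply Hstep; [assumption..|apply Rinv_INR_pos]. }
  assert (Hmono : forall m n, (n <= m)%nat -> forall x, As m x -> As n x).
  { induction m; intros n Hn x Hx.
    - now replace n with 0%nat by lia.
    - destruct (Nat.eq_dec n (S m)) as [->|]; [assumption|].
      apply IHm; [lia|]. now destruct Hx. }
  assert (Hdiam : forall n x y, As (S n) x -> As (S n) y -> dist x y < 2 * / INR (S n)).
  { intros n x y [_ Hx] [_ Hy].
    match type of Hx with dist x ?c < _ => pose proof (dist_tri x c y) as T; rewrite (dist_sym c y) in T end.
    lra. }
  assert (Hne : forall n, exists x, As n x).
  { intros n. apply NNPP. intros H. apply (proj2 (HAs n)). exists 1. split; [lra|].
    intros x Hx. exfalso. apply H. now exists x. }
  set (u := fun n => epsilon o (As n)).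
  assert (Hu : forall n, As n (u n)) by (intros; apply epsilon_spec, Hne).
  destruct (Hcomp u) as [c Hc].
  { intros e He. destruct (small_inv (e / 2)) as [N HN]; [lra|]. exists (S N). intros p q Hp Hq.
    specialize (HN N (le_n _)).
    assert (dist (u p) (u q) < 2 * / INR (S N)); [|lra].
    apply Hdiam; [apply (Hmono p)|apply (Hmono q)]; auto. }
  (* The limit may lie outside [K], so the cover has to be one of the whole space. One member
     contains the [r]-ball about [c], which makes a late stage good after all. *)
  destruct (Hcov c) as [U [HU HUc]]. destruct (Hop U HU c HUc) as [r [Hr HUr]].
  destruct (small_inv (r / 6)) as [N HN]; [lra|]. specialize (HN N (le_n _)).
  destruct (Hc (r / 3)) as [M HM]; [lra|].
  apply (proj2 (HAs (S N))). exists (r / 3). split; [lra|].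
  intros x Hx. exists U. split; [assumption|]. intros y Hy. apply HUr.
  set (k := (S N + M)%nat).
  assert (As (S N) (u k)) by (apply (Hmono k); [unfold k; lia|apply Hu]).
  pose proof (Hdiam N x (u k) Hx H) as D1.
  specialize (HM k ltac:(unfold k; lia)).
  pose proof (dist_tri c (u k) y) as T1. pose proof (dist_tri (u k) x y) as T2.
  rewrite (dist_sym c (u k)) in T1. rewrite (dist_sym (u k) x) in T2. lra.
Qed.

End CompleteCAT0.

(** * A Helly theorem for products of families of convex sets *)

Lemma cup_dim_0 (lab : nat -> nat -> nat) i I v :
  face I -> dim I = 0%nat -> labelled lab i I [v] -> cup lab i I [v] = true.
Proof.
  revert i. induction I as [|L I IH]; intros i F H Hl; [reflexivity|].
  inversion F as [|? ? [H1 H2] HF]; subst. apply labelled_cons in Hl as [Hl1 Hl2].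
  simpl in H. destruct L as [|a [|b L]]; [congruence| |simpl in H; lia].
  cbn [cup]. apply andb_true_iff. split; [|apply IH; auto].
  apply surj_spec. intros x [<-|[]]. left. destruct (Hl1 v) as [E|[]]; auto. now left.
Qed.

Fixpoint tuples {A : Type} (l : list A) (n : nat) : list (list A) :=
  match n with
  | O => [[]]
  | S n' => flat_map (fun a => map (cons a) (tuples l n')) l
  end.

Lemma in_tuples {A} (l t : list A) n :
  length t = n -> incl t l -> In t (tuples l n).
Proof.
  intros <-. induction t as [|a t IH]; intros H; [now left|].
  simpl. apply in_flat_map. exists a. split; [apply H; now left|].
  apply in_map, IH. intros x Hx. apply H. now right.
Qed.

Lemma uniform_bound {A} (l : list A) (P : A -> R -> Prop) :
  (forall a r r', P a r -> r <= r' -> P a r') ->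
  (forall a, In a l -> exists r, P a r) -> exists r, 0 <= r /\ forall a, In a l -> P a r.
Proof.
  intros Hm H. induction l as [|a l IH].
  - exists 0. split; [lra|contradiction].
  - destruct IH as [r [Hr IH]]; [intros; apply H; now right|].
    destruct (H a (or_introl eq_refl)) as [r' Hr'].
    exists (Rmax r r'). split; [eapply Rle_trans; [exact Hr|apply Rmax_l]|].
    intros b [<-|Hb]; eapply Hm; eauto; [apply Rmax_r|apply Rmax_l].
Qed.

Section ProductHelly.

Context {X : Type} (dist : X -> X -> R)
  (Hmet : is_metric dist) (Hcomp : complete dist) (Hcat : CAT0 dist).

Context (o : X) (q k : nat) (C : nat -> nat -> X -> Prop).

(** The facet opposite to the vertex [b] of the [i]-th simplex belongs to [C i b], so a face belongs
    to the sets of all such facets that contain it. *)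
Definition in_face (I : list (list nat)) (x : X) : Prop :=
  forall i b, (i < q)%nat -> (b < k)%nat -> ~ In b (nth i I []) -> C i b x.

Definition face_of_product (I : list (list nat)) : Prop :=
  face I /\ length I = q /\ forall i, incl (nth i I []) (seq 0 k).

Definition pt (I : list (list nat)) : X := epsilon (inhabits o) (in_face I).

(** The image of the fundamental chain of a face of dimension [m]: the chain of its boundary is
    contracted in [S K] steps to a point of its intersection. [K] controls the mesh. At full time
    the contraction is constant, so the closing cone adds only degenerate tuples. *)
Fixpoint chain (K m : nat) (I : list (list nat)) : list (list X) :=
  match m with
  | O => [[pt I]]
  | S m' => fill (fun s => contract dist (pt I) (INR s / INR (S K))) (S K) (pt I)
              (flat_map (chain K m') (facets I))
  end.

(** A region that contains the chains for all [K] at once: the Lebesgue number has to be found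
    before [K] is chosen. *)
Fixpoint cone_set (m : nat) (I : list (list nat)) (x : X) : Prop :=
  match m with
  | O => x = pt I
  | S m' => x = pt I \/ exists y t,
      (exists J, In J (facets I) /\ cone_set m' J y) /\ 0 <= t <= 1 /\ x = contract dist (pt I) t y
  end.

Context
  (Hcv : forall i b, (i < q)%nat -> (b < k)%nat -> convex dist (C i b))
  (Hne : forall a : nat -> nat, (forall i, (i < q)%nat -> (a i < k)%nat) ->
     exists x, forall i b, (i < q)%nat -> (b < k)%nat -> b <> a i -> C i b x).

Lemma face_of_facet I J : face_of_product I -> In J (facets I) -> face_of_product J.
Proof.
  intros (H1 & H2 & H3) HJ. split; [eapply facets_face; eauto|]. split.
  - erewrite facets_length; eauto.
  - intros i x Hx. apply (H3 i). eapply facets_incl; eauto.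
Qed.

Lemma in_face_facet I J x : In J (facets I) -> in_face J x -> in_face I x.
Proof.
  intros HJ Hx i b Hi Hb Hn. apply Hx; auto. intros Hin. apply Hn. eapply facets_incl; eauto.
Qed.

Lemma pt_in_face I : face_of_product I -> in_face I (pt I).
Proof.
  intros (H1 & H2 & H3). unfold pt. apply epsilon_spec.
  destruct (Hne (fun i => hd 0%nat (nth i I []))) as [x Hx].
  - intros i Hi. assert (Hin : In (hd 0%nat (nth i I [])) (seq 0 k)).
    { apply (H3 i). unfold face in H1. rewrite Forall_forall in H1.
      destruct (H1 (nth i I [])) as [Hn _]; [apply nth_In; lia|].
      destruct (nth i I []); [congruence|now left]. }
    apply in_seq in Hin. lia.
  - exists x. intros i b Hi Hb Hn. apply Hx; auto. intros ->. apply Hn.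
    unfold face in H1. rewrite Forall_forall in H1.
    destruct (H1 (nth i I [])) as [Hn' _]; [apply nth_In; lia|].
    destruct (nth i I []); [congruence|now left].
Qed.

Lemma convex_in_face I : convex dist (in_face I).
Proof.
  intros x y c s Hx Hy G Hs i b Hi Hb Hn. apply (Hcv i b Hi Hb x y); auto.
Qed.

Lemma step_range s K : (s <= S K)%nat -> 0 <= INR s / INR (S K) <= 1.
Proof.
  intros H. assert (Hpos : 0 < INR (S K)) by (apply lt_0_INR; lia). split.
  - unfold Rdiv. apply Rmult_le_pos; [apply pos_INR|]. left. now apply Rinv_0_lt_compat.
  - apply Rmult_le_reg_r with (INR (S K)); [assumption|].
    unfold Rdiv. rewrite Rmult_assoc, Rinv_l by lra.
    rewrite Rmult_1_r, Rmult_1_l. now apply le_INR.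
Qed.

Lemma chain_spec K m I t :
  face_of_product I -> dim I = m -> In t (chain K m I) ->
  length t = S m /\ forall x, In x t -> in_face I x /\ cone_set m I x.
Proof.
  revert I t. induction m as [|m IH]; intros I t HI Hd Ht.
  - destruct Ht as [<-|[]]. split; [reflexivity|]. intros x [<-|[]].
    split; [now apply pt_in_face|reflexivity].
  - change (In t (fill (fun s => contract dist (pt I) (INR s / INR (S K))) (S K) (pt I)
              (flat_map (chain K m) (facets I)))) in Ht.
    assert (HZ : forall r, In r (flat_map (chain K m) (facets I)) -> length r = S m /\
      forall x s, In x r -> (s <= S K)%nat -> in_face I (contract dist (pt I) (INR s / INR (S K)) x) /\
        cone_set (S m) I (contract dist (pt I) (INR s / INR (S K)) x)).
    { intros r Hr. apply in_flat_map in Hr as [J [HJ Hr]].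
      destruct (IH J r) as [Hlr Hpr]; [eapply face_of_facet; eauto| |assumption|].
      { pose proof (facets_dim _ _ HJ). lia. }
      split; [assumption|]. intros x s Hx Hs. destruct (Hpr x Hx) as [Hf Hc]. split.
      - apply (contract_convex dist Hmet Hcat); [apply convex_in_face|now apply pt_in_face|
          eapply in_face_facet; eauto|now apply step_range].
      - right. exists x, (INR s / INR (S K)). split; [now exists J|].
        split; [now apply step_range|reflexivity]. }
    apply fill_in in Ht as [(s & r & Hs & Hr & Ht)|(r & Hr & ->)].
    + destruct (HZ r Hr) as [Hlr Hpr]. split.
      * rewrite (prism_length _ _ _ _ Ht). lia.
      * intros x Hx. destruct (prism_in _ _ _ _ _ Ht Hx) as [y [Hy [->| ->]]];
        apply Hpr; auto; lia.
    + destruct (HZ r Hr) as [Hlr Hpr]. split; [simpl; rewrite length_map; lia|].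
      intros x [<-|Hx].
      * split; [now apply pt_in_face|now left].
      * apply in_map_iff in Hx as [y [<- Hy]]. apply Hpr; auto.
Qed.

(** The chains of the facets form a cycle, because each face of codimension two occurs an even
    number of times among the facets of facets; in dimension one this is the even number of end
    points. *)
Lemma chain_boundary K m I (phi : list X -> bool) :
  dim I = S m ->
  par phi (flat_map dels (chain K (S m) I)) = par phi (flat_map (chain K m) (facets I)).
Proof.
  revert I phi. induction m as [|m IH]; intros I phi Hd;
  change (chain K (S ?m) I) with (fill (fun s => contract dist (pt I) (INR s / INR (S K))) (S K) (pt I)
              (flat_map (chain K m) (facets I))); apply fill_boundary.
  - intros x. unfold Rdiv. simpl (INR 0). rewrite Rmult_0_l. now apply contract_0.
  - intros psi. rewrite !par_flat_map. simpl.
    apply par_facets_one. exact Hd.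
  - intros x. unfold Rdiv. simpl (INR 0). rewrite Rmult_0_l. now apply contract_0.
  - intros psi. rewrite par_flat_map, par_flat_map.
    rewrite (par_ext_in _ (fun J => par (fun L => par psi (chain K m L)) (facets J))).
    + rewrite <- par_flat_map. apply par_facets_facets.
    + intros J HJ. rewrite <- par_flat_map, IH, par_flat_map; [reflexivity|].
      pose proof (facets_dim _ _ HJ). lia.
Qed.

Lemma cone_set_totally_bounded m I : totally_bounded dist (cone_set m I).
Proof.
  revert I. induction m as [|m IH]; intros I.
  - now apply totally_bounded_single.
  - intros e He.
    destruct (totally_bounded_cone dist Hmet Hcat _ (pt I)
      (totally_bounded_union dist (facets I) (cone_set m) (fun J _ => IH J)) e He) as [l Hl].
    exists (pt I :: l). intros x [->|Hx].
    + exists (pt I). rewrite (dist_refl dist Hmet). split; [now left|assumption].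
    + destruct (Hl x) as [y [Hy Hd]]; [exact Hx|]. exists y. split; [now right|assumption].
Qed.

(** [D] does not depend on [K]. Contraction does not enlarge the tuples coming from the facets, and
    between consecutive times a point moves by its distance from the apex, which is bounded, divided
    by [S K]. *)
Lemma chain_small m I :
  face_of_product I -> dim I = m ->
  exists D, 0 <= D /\ forall K t x y, In t (chain K m I) -> In x t -> In y t ->
    dist x y <= D / INR (S K).
Proof.
  revert I. induction m as [|m IH]; intros I HI Hd.
  - exists 0. split; [lra|]. intros K t x y [<-|[]] [<-|[]] [<-|[]].
    rewrite (dist_refl dist Hmet). unfold Rdiv. lra.
  - destruct (uniform_bound (facets I) (fun J D => forall K t x y, In t (chain K m J) -> In x t -> In y t ->
      dist x y <= D / INR (S K))) as [D [HD HDJ]].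
    { intros J r r' H Hr K t x y Ht Hx Hy. eapply Rle_trans; [now apply (H K t)|].
      apply Rmult_le_compat_r; [left; apply Rinv_INR_pos|assumption]. }
    { intros J HJ. destruct (IH J) as [D [_ HD]]; [eapply face_of_facet; eauto| |now exists D].
      pose proof (facets_dim _ _ HJ). lia. }
    destruct (uniform_bound (facets I) (fun J B => forall x, cone_set m J x -> dist (pt I) x <= B))
      as [B [HB HBJ]].
    { intros J r r' H Hr x Hx. specialize (H x Hx). lra. }
    { intros J HJ. apply totally_bounded_bounded; [assumption|apply cone_set_totally_bounded]. }
    exists (D + B). split; [lra|]. intros K t x y Ht Hx Hy.
    pose proof (Rinv_INR_pos K) as HK.
    assert (HZ : forall r, In r (flat_map (chain K m) (facets I)) ->
      forall x y, In x r -> In y r -> dist x y <= D / INR (S K) /\ dist (pt I) y <= B).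
    { intros r Hr x' y' Hx' Hy'. apply in_flat_map in Hr as [J [HJ Hr]].
      split; [now apply (HDJ J HJ K r)|]. apply (HBJ J HJ).
      apply (chain_spec K m J r); auto; [eapply face_of_facet; eauto|].
      pose proof (facets_dim _ _ HJ). lia. }
    change (In t (fill (fun s => contract dist (pt I) (INR s / INR (S K))) (S K) (pt I)
              (flat_map (chain K m) (facets I)))) in Ht.
    assert (HDB : 0 <= (D + B) / INR (S K)).
    { unfold Rdiv. apply Rmult_le_pos; lra. }
    apply fill_in in Ht as [(s & r & Hs & Hr & Ht)|(r & Hr & ->)].
    + assert (G : forall a b x' y', (a = s \/ a = S s) -> (b = s \/ b = S s) -> In x' r -> In y' r ->
        dist (contract dist (pt I) (INR a / INR (S K)) x') (contract dist (pt I) (INR b / INR (S K)) y')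
          <= (D + B) / INR (S K)).
      { intros a b x' y' Ha Hb Hx' Hy'. destruct (HZ r Hr x' y' Hx' Hy') as [H1 H2].
        assert (Ra : 0 <= INR a / INR (S K) <= 1) by (apply step_range; lia).
        assert (Rb : 0 <= INR b / INR (S K) <= 1) by (apply step_range; lia).
        eapply Rle_trans; [apply (dist_tri dist Hmet) with (y := contract dist (pt I) (INR a / INR (S K)) y')|].
        unfold Rdiv at 5. rewrite Rmult_plus_distr_r. apply Rplus_le_compat.
        - eapply Rle_trans; [apply contract_lip; assumption|exact H1].
        - rewrite contract_time by assumption. rewrite Rmult_comm.
          pose proof (dist_nonneg dist Hmet (pt I) y') as Hp.
          apply Rmult_le_compat; [assumption|apply Rabs_pos|assumption|].
          replace (INR a / INR (S K) - INR b / INR (S K)) with ((INR a - INR b) * / INR (S K))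
            by (unfold Rdiv; ring).
          rewrite Rabs_mult, (Rabs_right (/ _)) by lra.
          rewrite <- (Rmult_1_l (/ INR (S K))) at 2. apply Rmult_le_compat_r; [lra|].
          assert (HS : INR (S s) = INR s + 1) by apply S_INR.
          destruct Ha as [->| ->], Hb as [->| ->]; rewrite ?HS; apply Rabs_le; lra. }
      destruct (prism_in _ _ _ _ _ Ht Hx) as [x' [Hx' Ex]].
      destruct (prism_in _ _ _ _ _ Ht Hy) as [y' [Hy' Ey]].
      destruct Ex as [->| ->], Ey as [->| ->]; apply G; auto.
    + assert (E : forall z, In z (pt I :: map (contract dist (pt I) (INR (S K) / INR (S K))) r) -> z = pt I).
      { intros z [<-|Hz]; [reflexivity|]. apply in_map_iff in Hz as [w [<- _]].
        unfold Rdiv. rewrite Rinv_r by (apply not_0_INR; lia). now apply contract_1. }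
      rewrite (E x Hx), (E y Hy), (dist_refl dist Hmet). assumption.
Qed.

Lemma cone_set_facet m I J x : In J (facets I) -> cone_set m J x -> cone_set (S m) I x.
Proof.
  intros HJ Hx. right. exists x, 0. split; [now exists J|]. split; [lra|].
  symmetry. now apply contract_0.
Qed.

(* Sperner's lemma for products of simplices: [cup] detects the fully labelled tuples. *)
Lemma chain_degree_one (lab : nat -> nat -> nat) (v : X -> nat) (G : X -> Prop) K m I :
  (forall J x i, face_of_product J -> G x -> in_face J x -> (i < q)%nat -> In (lab i (v x)) (nth i J [])) ->
  face_of_product I -> dim I = m -> (forall x, cone_set m I x -> G x) ->
  par (fun t => cup lab 0 I (isort (map v t))) (chain K m I) = true.
Proof.
  intros Hlab. revert I. induction m as [|m IH]; intros I HI Hd HG.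
  - simpl. rewrite cup_dim_0; [reflexivity|apply HI|assumption|].
    intros w j [<-|[]] Hj. apply Hlab; auto.
    + apply HG. reflexivity.
    + now apply pt_in_face.
    + destruct HI as (_ & H2 & _). simpl in *. lia.
  - assert (Hl : forall J t, face_of_product J -> dim J = m -> In J (facets I) -> In t (chain K m J) ->
      labelled lab 0 J (map v t)).
    { intros J t HJ HdJ HJI Ht w j Hw Hj. apply in_map_iff in Hw as [x [<- Hx]].
      destruct (chain_spec K m J t HJ HdJ Ht) as [_ H]. destruct (H x Hx) as [H1 H2].
      apply Hlab; auto; [|destruct HJ as (_ & HJ & _); simpl; lia].
      apply HG. eapply cone_set_facet; eauto. }
    destruct (facets_head I) as (pre & b & L & post & rest & H1 & H2 & H3 & H4); [lia|apply HI|].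
    set (I' := pre ++ L :: post) in *.
    (* By [cup_shrink] the count over the chain of [I] becomes a count over its boundary with the
       cochain of the first facet. Every other facet lacks a vertex which that cochain requires, so
       only the first facet contributes. *)
    rewrite (par_ext_in _ (fun t => par (fun r => cup lab 0 I' (isort (map v r))) (dels t))).
    + rewrite <- par_flat_map, chain_boundary by assumption.
      rewrite par_flat_map, H3. simpl.
      assert (HI'I : In I' (facets I)) by (rewrite H3; now left).
      rewrite IH.
      * rewrite par_false_in; [reflexivity|]. intros J HJ.
        assert (HJI : In J (facets I)) by (rewrite H3; now right).
        apply par_false_in. intros t Ht.
        destruct (H4 J HJ) as (i & e & He & He').
        assert (Hi : (i < length J)%nat).
        { destruct (Nat.lt_ge_cases i (length J)) as [Hi|Hi]; [assumption|].
          rewrite (nth_overflow I') in He; [destruct He|].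
          rewrite (facets_length _ _ HI'I), <- (facets_length _ _ HJI). exact Hi. }
        apply (cup_missing lab 0 I' _ i e He). intros w Hw E.
        apply He'. rewrite <- E. apply (Hl J t); auto.
        -- eapply face_of_facet; eauto.
        -- pose proof (facets_dim _ _ HJI). lia.
        -- apply (Permutation_in _ (isort_perm _)). exact Hw.
      * eapply face_of_facet; eauto.
      * pose proof (facets_dim _ _ HI'I). lia.
      * intros x Hx. apply HG. eapply cone_set_facet; eauto.
    + intros t Ht. destruct (chain_spec K (S m) I t HI Hd Ht) as [Hlt Hpt].
      rewrite <- (par_map (fun r => cup lab 0 I' (isort r)) (map v)), <- dels_map.
      rewrite (par_isort_dels (cup lab 0 I')).
      unfold I'. rewrite (cup_shrink lab 0 pre b L post).
      * now rewrite <- H2.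
      * assumption.
      * rewrite <- H2. apply HI.
      * rewrite <- H2, Hd, <- Hlt.
        rewrite (Permutation_length (isort_perm _)). apply length_map.
      * rewrite <- H2. intros w j Hw Hj.
        apply (Permutation_in _ (isort_perm _)) in Hw.
        apply in_map_iff in Hw as [x [<- Hx]]. destruct (Hpt x Hx) as [P1 P2].
        apply Hlab; auto. destruct HI as (_ & HI & _). simpl; lia.
Qed.

Lemma full_face : (0 < k)%nat ->
  face_of_product (repeat (seq 0 k) q) /\ dim (repeat (seq 0 k) q) = (q * (k - 1))%nat.
Proof.
  intros Hk. split; [split; [|split]|].
  - apply Forall_forall. intros L HL. apply repeat_spec in HL. subst. split.
    + destruct k; [lia|discriminate].
    + apply seq_NoDup.
  - apply repeat_length.
  - intros i x Hx. destruct (Nat.lt_ge_cases i q) as [Hi|Hi].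
    + now rewrite nth_repeat_lt in Hx by assumption.
    + rewrite nth_overflow in Hx by now rewrite repeat_length. destruct Hx.
  - clear. induction q as [|p IH]; [reflexivity|]. simpl. rewrite length_seq, IH. lia.
Qed.

Lemma tuples_choice n (P : nat -> nat -> Prop) :
  (forall i, (i < n)%nat -> exists b, (b < k)%nat /\ P i b) ->
  exists a, In a (tuples (seq 0 k) n) /\ forall i, (i < n)%nat -> P i (nth i a 0%nat).
Proof.
  revert P. induction n as [|n IH]; intros P H.
  - exists []. split; [now left|lia].
  - destruct (IH (fun i => P (S i))) as [a [Ha Ha']]; [intros; apply H; lia|].
    destruct (H 0%nat) as [b [Hb Hb']]; [lia|]. exists (b :: a). split.
    + apply in_flat_map. exists b. split; [apply in_seq; lia|]. now apply in_map.
    + intros [|i] Hi; simpl; [assumption|apply Ha'; lia].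
Qed.

Lemma tuples_lt n a i : In a (tuples (seq 0 k) n) -> (i < n)%nat -> (nth i a 0 < k)%nat.
Proof.
  revert a i. induction n as [|n IH]; intros a i Ha Hi; [lia|].
  simpl in Ha. apply in_flat_map in Ha as [b [Hb Ha]]. apply in_seq in Hb.
  apply in_map_iff in Ha as [a' [<- Ha']]. destruct i; simpl; [lia|]. apply IH; [assumption|lia].
Qed.

Lemma product_helly d :
  covdim_le dist d -> (d < q * (k - 1))%nat ->
  (forall i b, (i < q)%nat -> (b < k)%nat -> closed dist (C i b)) ->
  exists i, (i < q)%nat /\ exists x, forall b, (b < k)%nat -> C i b x.
Proof.
  intros Hdim Hd Hcl. apply NNPP. intros Hno.
  assert (Hk : (0 < k)%nat) by nia.
  assert (Hmiss : forall i x, (i < q)%nat -> exists b, (b < k)%nat /\ ~ C i b x).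
  { intros i x Hi. apply NNPP. intros H. apply Hno. exists i. split; [assumption|].
    exists x. intros b Hb. apply NNPP. intros H'. apply H. now exists b. }
  (* A tuple [a] names one set to avoid in each factor. There are finitely many tuples, so the cover
     is finite, as [covdim_le] demands. *)
  set (U := fun a x => forall i, (i < q)%nat -> ~ C i (nth i a 0%nat) x).
  destruct (Hdim (map U (tuples (seq 0 k) q))) as (Vs & HVo & HVc & HVr & HVd).
  { intros V HV. apply in_map_iff in HV as [a [<- Ha]]. unfold U.
    assert (G : forall n, (n <= q)%nat -> is_open dist (fun x => forall i, (i < n)%nat -> ~ C i (nth i a 0%nat) x)).
    { induction n as [|n IH]; intros Hn x Hx; [exists 1; split; [lra|lia]|].
      destruct (IH ltac:(lia) x (fun i Hi => Hx i (Nat.lt_lt_succ_r _ _ Hi))) as [e1 [He1 H1]].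
      assert (Hna : (nth n a 0 < k)%nat) by (eapply tuples_lt; eauto).
      destruct (closed_compl_open dist (C n (nth n a 0%nat)) (Hcl n _ ltac:(lia) Hna) x ltac:(apply Hx; lia)) as [e2 [He2 H2]].
      exists (Rmin e1 e2). split; [now apply Rmin_glb_lt|]. intros y Hy i Hi.
      destruct (Nat.eq_dec i n) as [->|Hin].
      - apply H2. eapply Rlt_le_trans; [exact Hy|apply Rmin_r].
      - apply H1; [|lia]. eapply Rlt_le_trans; [exact Hy|apply Rmin_l]. }
    apply G. lia. }
  { intros x. destruct (tuples_choice q (fun i b => ~ C i b x)) as [a [Ha Ha']].
    - intros i Hi. now apply Hmiss.
    - exists (U a). split; [now apply in_map|exact Ha']. }
  set (V := fun w => nth w Vs (fun _ => False)).
  (* Each member of the refinement inherits the labels of one [U a] that contains it: its [i]-th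
     label is the [i]-th entry of [a]. *)
  set (vec := fun w => epsilon (inhabits (@nil nat)) (fun a => In a (tuples (seq 0 k) q) /\ forall x, V w x -> U a x)).
  assert (Hvec : forall w, (w < length Vs)%nat -> In (vec w) (tuples (seq 0 k) q) /\ forall x, V w x -> U (vec w) x).
  { intros w Hw. unfold vec. apply epsilon_spec. destruct (HVr (V w)) as [V' [HV' H]].
    - now apply nth_In.
    - apply in_map_iff in HV' as [a [<- Ha]]. exists a. auto. }
  destruct (full_face Hk) as [HF HdF].
  set (F := repeat (seq 0 k) q) in *. set (N := (q * (k - 1))%nat) in *.
  set (G := cone_set N F).
  destruct (lebesgue_number dist Hmet Hcomp G (fun W => In W Vs)
    (cone_set_totally_bounded N F) HVo HVc) as [e [He HG]].
  (* A point is labelled by a member of the refinement that contains its whole [e]-ball, hence every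
     other point of a tuple of diameter below [e]. *)
  set (v := fun x => epsilon (inhabits 0%nat) (fun w => (w < length Vs)%nat /\ forall y, dist x y < e -> V w y)).
  assert (Hv : forall x, G x -> (v x < length Vs)%nat /\ forall y, dist x y < e -> V (v x) y).
  { intros x Hx. unfold v. apply epsilon_spec. destruct (HG x Hx) as [W [HW HW']].
    apply (In_nth _ _ (fun _ => False)) in HW as [w [Hw <-]]. now exists w. }
  set (lab := fun i w => nth i (vec w) 0%nat).
  destruct (chain_small N F HF HdF) as [D [HD Hsmall]].
  destruct (small_inv (e / (D + 1))) as [K HK]; [apply Rdiv_lt_0_compat; lra|].
  specialize (HK K (le_n _)).
  assert (HDe : D / INR (S K) < e).
  { pose proof (Rinv_INR_pos K).
    apply Rle_lt_trans with (/ INR (S K) * (D + 1)); [unfold Rdiv; nra|].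
    apply Rlt_le_trans with (e / (D + 1) * (D + 1)); [apply Rmult_lt_compat_r; lra|].
    right. field. lra. }
  assert (Hodd : par (fun t => cup lab 0 F (isort (map v t))) (chain K N F) = true).
  { apply (chain_degree_one lab v G); auto.
    intros J x i HJ Hx HxJ Hi. destruct (Hv x Hx) as [H1 H2].
    destruct (Hvec (v x) H1) as [H3 H4].
    (* Sperner's condition: a point of a face lies in [C i b] for each [b] missing from the face,
       whereas its label names a set that it avoids. *)
    apply NNPP. intros Hn.
    assert (Hin : V (v x) x) by (apply H2; rewrite (dist_refl dist Hmet); assumption).
    apply (H4 x Hin i Hi). apply HxJ; auto.
    eapply tuples_lt; eauto. }
  apply par_true_ex in Hodd as [t [Ht Hc]].
  destruct (chain_spec K N F t HF HdF Ht) as [Hlt Hpt].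
  assert (Hlen : length (isort (map v t)) = S N).
  { rewrite (Permutation_length (isort_perm _)), length_map. exact Hlt. }
  assert (ND : NoDup (isort (map v t))).
  { eapply cup_NoDup; [apply HF|apply isort_sorted| |exact Hc]. now rewrite HdF. }
  destruct t as [|x0 t]; [discriminate|].
  assert (Hle : (length (isort (map v (x0 :: t))) <= S d)%nat); [|lia].
  apply (HVd x0); [assumption|].
  intros w Hw. apply (Permutation_in _ (isort_perm _)) in Hw.
  apply in_map_iff in Hw as [x [<- Hx]].
  destruct (Hv x) as [H1 H2]; [now apply Hpt|]. split; [assumption|].
  apply H2. eapply Rle_lt_trans; [|exact HDe]. apply (Hsmall K (x0 :: t)); auto. now left.
Qed.

End ProductHelly.

(** * Reduced words *)

Open Scope nat_scope.

(** The left factor may be any word, reduced or not, and acts letter by letter on normal forms; this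
    allows computing with unreduced products. *)
Definition mulw (u v : list nat) : list nat := fold_right push v u.

Lemma mulw_app u1 u2 v : mulw (u1 ++ u2) v = mulw u1 (mulw u2 v).
Proof. apply fold_right_app. Qed.

Lemma mulw_reduced n u v :
  (forall a, In a u -> a < n) -> reducedb n v = true -> reducedb n (mulw u v) = true.
Proof.
  induction u as [|a u IH]; simpl; intros Hu Hv; [assumption|].
  apply push_reduced; [apply Nat.ltb_lt; auto|apply IH; auto].
Qed.

Lemma reduced_lt n u a : reducedb n u = true -> In a u -> a < n.
Proof.
  induction u as [|b u IH]; simpl; [contradiction|].
  intros H [<-|Ha].
  - apply andb_true_iff in H as [H _]. apply andb_true_iff in H as [H _]. now apply Nat.ltb_lt.
  - apply andb_true_iff in H as [_ H]. auto.
Qed.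

Lemma reduced_app_l n u v : reducedb n (u ++ v) = true -> reducedb n u = true.
Proof.
  induction u as [|a u IH]; simpl; intros H; [reflexivity|].
  apply andb_true_iff in H as [H H']. rewrite (IH H').
  apply andb_true_iff in H as [H1 H2]. rewrite H1.
  destruct u; simpl in *; [reflexivity|]. now rewrite H2.
Qed.

Lemma reduced_app_r n u v : reducedb n (u ++ v) = true -> reducedb n v = true.
Proof.
  induction u as [|a u IH]; simpl; intros H; [assumption|].
  apply andb_true_iff in H as [_ H]. auto.
Qed.

Lemma reduced_glue n u c v :
  reducedb n (u ++ [c]) = true -> reducedb n (c :: v) = true -> reducedb n (u ++ c :: v) = true.
Proof.
  induction u as [|a u IH]; intros H H'; [assumption|].
  simpl app in *. simpl in H. apply andb_true_iff in H as [H1 H2].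
  change (Nat.ltb a n && match u ++ c :: v with [] => true | b :: _ => negb (Nat.eqb a b) end
    && reducedb n (u ++ c :: v) = true).
  rewrite IH by assumption. rewrite andb_true_r.
  destruct u; exact H1.
Qed.

Lemma push_push n a v : reducedb n v = true -> push a (push a v) = v.
Proof.
  destruct v as [|b v]; simpl; [now rewrite Nat.eqb_refl|].
  intros H. destruct (Nat.eqb_spec a b) as [->|E].
  - destruct v as [|c v]; simpl; [reflexivity|].
    apply andb_true_iff in H as [H _]. apply andb_true_iff in H as [_ H].
    apply negb_true_iff in H. now rewrite H.
  - simpl. now rewrite Nat.eqb_refl.
Qed.

Lemma push_cons n a v : reducedb n (a :: v) = true -> push a v = a :: v.
Proof.
  simpl. destruct v as [|b v]; simpl; [reflexivity|]. intros H.
  apply andb_true_iff in H as [H _]. apply andb_true_iff in H as [_ H].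
  apply negb_true_iff in H. now rewrite H.
Qed.

Lemma mulw_reduced_app n u v : reducedb n (u ++ v) = true -> mulw u v = u ++ v.
Proof.
  induction u as [|a u IH]; intros H; [reflexivity|].
  simpl app in *. simpl mulw. rewrite IH.
  - now apply (push_cons n).
  - simpl in H. now apply andb_true_iff in H as [_ H].
Qed.

Lemma mulw_nil_r n u : reducedb n u = true -> mulw u [] = u.
Proof. intros H. rewrite (mulw_reduced_app n); rewrite app_nil_r; auto. Qed.

Lemma mulw_push n a u v :
  reducedb n u = true -> reducedb n v = true -> mulw (push a u) v = push a (mulw u v).
Proof.
  intros Hu Hv. destruct u as [|b u]; [reflexivity|].
  simpl. destruct (Nat.eqb_spec a b) as [->|E]; [|reflexivity].
  symmetry. apply (push_push n). apply mulw_reduced; [|assumption].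
  intros c Hc. apply (reduced_lt n (b :: u)); [assumption|now right].
Qed.

Lemma mulw_assoc n u v w :
  (forall a, In a u -> a < n) -> reducedb n v = true -> reducedb n w = true ->
  mulw (mulw u v) w = mulw u (mulw v w).
Proof.
  intros Hu Hv Hw. induction u as [|a u IH]; [reflexivity|].
  simpl. rewrite (mulw_push n); [|apply mulw_reduced; auto using in_cons|assumption].
  rewrite IH by auto using in_cons. reflexivity.
Qed.

Lemma mulw_rev n u v :
  (forall a, In a u -> a < n) -> reducedb n v = true -> mulw u (mulw (rev u) v) = v.
Proof.
  revert v. induction u as [|a u IH]; intros v Hu Hv; [reflexivity|].
  simpl rev. rewrite mulw_app. simpl.
  rewrite IH; [now apply (push_push n)|auto using in_cons|].
  apply push_reduced; [apply Nat.ltb_lt; auto using in_eq|assumption].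
Qed.

Lemma mulw_length u v : length (mulw u v) <= length u + length v.
Proof.
  induction u as [|a u IH]; simpl; [lia|].
  assert (H : forall w, length (push a w) <= S (length w)).
  { intros [|b w]; simpl; [lia|]. destruct (Nat.eqb a b); simpl; lia. }
  specialize (H (mulw u v)). lia.
Qed.

(** If the first and last letters differed, [y] followed by itself would be reduced and nonempty. So
    they agree, and conjugation by that letter gives a shorter involution. *)
Lemma involution_palindrome n y :
  reducedb n y = true -> y <> [] -> mulw y y = [] -> exists w c, y = w ++ c :: rev w.
Proof.
  intros Hy Hne Hinv. remember (length y) as m eqn:Hm. revert y Hy Hne Hinv Hm.
  induction m as [m IH] using lt_wf_ind. intros y Hy Hne Hinv Hm.
  destruct y as [|a y]; [congruence|].
  destruct y as [|b y _] using rev_ind; [exists [], a; reflexivity|].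
  assert (Hab : a = b).
  { destruct (Nat.eq_dec a b) as [E|E]; [assumption|]. exfalso.
    rewrite (mulw_reduced_app n) in Hinv; [discriminate|].
    replace ((a :: y ++ [b]) ++ a :: y ++ [b]) with ((a :: y) ++ b :: (a :: y ++ [b]))
      by (simpl; rewrite <- app_assoc; reflexivity).
    apply reduced_glue; [exact Hy|].
    change (Nat.ltb b n && negb (Nat.eqb b a) && reducedb n (a :: y ++ [b]) = true).
    rewrite Hy, andb_true_r. apply andb_true_iff. split.
    - apply Nat.ltb_lt. apply (reduced_lt n (a :: y ++ [b])); [assumption|].
      right. apply in_app_iff. right. now left.
    - apply negb_true_iff, Nat.eqb_neq. congruence. }
  subst b.
  assert (Hyr : reducedb n y = true).
  { change (a :: y ++ [a]) with ([a] ++ (y ++ [a])) in Hy.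
    apply reduced_app_r in Hy. now apply reduced_app_l in Hy. }
  assert (Ha : Nat.ltb a n = true).
  { apply Nat.ltb_lt. apply (reduced_lt n (a :: y ++ [a])); [assumption|now left]. }
  assert (Hy1 : reducedb n (push a []) = true) by (apply push_reduced; auto).
  assert (Hlt : forall z, In z y -> z < n) by (intros; now apply (reduced_lt n y)).
  destruct (IH (length y)) with (y := y) as (w & c & E); auto.
  - rewrite Hm. simpl. rewrite length_app. simpl. lia.
  - intros ->. simpl in Hy. rewrite Nat.eqb_refl in Hy. simpl in Hy.
    now rewrite andb_false_r in Hy.
  - change (a :: y ++ [a]) with ([a] ++ (y ++ [a])) in Hinv.
    rewrite !mulw_app in Hinv. simpl in Hinv.
    rewrite Nat.eqb_refl in Hinv.
    assert (Hya : y ++ [a] = mulw y [a]).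
    { symmetry. apply (mulw_reduced_app n).
      change (a :: y ++ [a]) with ([a] ++ (y ++ [a])) in Hy. now apply reduced_app_r in Hy. }
    rewrite Hya in Hinv.
    apply (f_equal (push a)) in Hinv.
    assert (Hr : reducedb n [a] = true) by (simpl; now rewrite Ha).
    rewrite (push_push n) in Hinv by (apply mulw_reduced; auto; apply mulw_reduced; auto).
    rewrite <- (mulw_assoc n) in Hinv by auto.
    assert (Hinv2 : mulw (mulw (mulw y y) [a]) [a] = mulw [a] [a]) by (now rewrite Hinv).
    assert (Hyy : reducedb n (mulw y y) = true) by (apply mulw_reduced; auto).
    rewrite (mulw_assoc n) in Hinv2; auto.
    2: { intros z. now apply reduced_lt. }
    simpl in Hinv2. rewrite Nat.eqb_refl in Hinv2.
    now rewrite (mulw_nil_r n) in Hinv2.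
  - exists (a :: w), c. simpl. rewrite E. rewrite <- app_assoc. reflexivity.
Qed.

Definition prefix (p v : list nat) : Prop := exists r, v = p ++ r.

Lemma prefix_comparable p p' v : prefix p v -> prefix p' v -> prefix p p' \/ prefix p' p.
Proof.
  revert p' v. induction p as [|a p IH]; intros p' v [r Hr] [r' Hr'].
  - left. now exists p'.
  - destruct p' as [|b p']; [right; now exists (a :: p)|].
    subst v. simpl in Hr'. injection Hr' as <- E.
    destruct (IH p' (p ++ r)) as [[s Hs]|[s Hs]].
    + now exists r.
    + now exists r'.
    + left. exists s. now rewrite Hs.
    + right. exists s. now rewrite Hs.
Qed.

(* The words with prefix [w ++ [c]] form one side of the wall of the
   reflection [w c w^-1], which exchanges the two sides. *)
Lemma reflection_swaps_sides n w c v :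
  reducedb n (w ++ c :: rev w) = true -> reducedb n v = true ->
  ~ prefix (w ++ [c]) v -> prefix (w ++ [c]) (mulw (w ++ c :: rev w) v).
Proof.
  intros Hy Hv Hp. rewrite mulw_app. simpl.
  assert (Hwc : reducedb n (w ++ [c]) = true).
  { apply (reduced_app_l n _ (rev w)). rewrite <- app_assoc. exact Hy. }
  assert (Hw : forall a, In a w -> a < n).
  { intros a Ha. apply (reduced_lt n _ _ Hwc). apply in_app_iff. now left. }
  assert (Hw' : forall a, In a (rev w) -> a < n) by (intros a Ha; apply Hw; now apply in_rev).
  set (z := mulw (rev w) v).
  assert (Hz : reducedb n z = true) by (apply mulw_reduced; assumption).
  assert (Ev : mulw w z = v) by (apply (mulw_rev n); assumption).
  assert (Hc : Nat.ltb c n = true).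
  { apply Nat.ltb_lt. apply (reduced_lt n _ _ Hwc). apply in_app_iff. right. now left. }
  assert (Ez : push c z = c :: z).
  { destruct z as [|b z'] eqn:E; [reflexivity|]. simpl.
    destruct (Nat.eqb_spec c b) as [->|]; [|reflexivity]. exfalso. apply Hp.
    exists z'. rewrite <- Ev. rewrite <- app_assoc. simpl. apply (mulw_reduced_app n).
    now apply reduced_glue. }
  exists z. rewrite Ez, <- app_assoc. simpl. apply (mulw_reduced_app n).
  apply reduced_glue; [assumption|]. rewrite <- Ez. apply push_reduced; assumption.
Qed.

(** * Homomorphisms of [W n] *)

Section Universal.

Context {n : nat}.

Lemma W_ext (u v : W n) : proj1_sig u = proj1_sig v -> u = v.
Proof.
  destruct u as [u Hu], v as [v Hv]. simpl. intros ->. f_equal. apply UIP_dec, bool_dec.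
Qed.

Definition Wone : W n := exist _ [] eq_refl.

Lemma W_lt (u : W n) a : In a (proj1_sig u) -> a < n.
Proof. apply reduced_lt. apply (proj2_sig u). Qed.

Lemma Wmul_assoc (u v w : W n) : Wmul (Wmul u v) w = Wmul u (Wmul v w).
Proof.
  apply W_ext. simpl. apply (mulw_assoc n); [apply W_lt|apply (proj2_sig v)|apply (proj2_sig w)].
Qed.

Lemma Wmul_1_l (u : W n) : Wmul Wone u = u.
Proof. now apply W_ext. Qed.

Lemma Wmul_1_r (u : W n) : Wmul u Wone = u.
Proof. apply W_ext. simpl. apply (mulw_nil_r n), (proj2_sig u). Qed.

Lemma gen_reduced a : reducedb n (if Nat.ltb a n then [a] else []) = true.
Proof. destruct (Nat.ltb a n) eqn:E; simpl; [now rewrite E|reflexivity]. Qed.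

(* Junk value: [gen a] is the unit for [a >= n]. *)
Definition gen (a : nat) : W n := exist _ _ (gen_reduced a).

Lemma gen_val a : a < n -> proj1_sig (gen a) = [a].
Proof. intros H. simpl. apply Nat.ltb_lt in H. now rewrite H. Qed.

Lemma gen_sq a : Wmul (gen a) (gen a) = Wone.
Proof.
  apply W_ext. simpl. destruct (Nat.ltb a n); simpl; [now rewrite Nat.eqb_refl|reflexivity].
Qed.

Lemma gen_sq_l a (u : W n) : Wmul (gen a) (Wmul (gen a) u) = u.
Proof. now rewrite <- Wmul_assoc, gen_sq, Wmul_1_l. Qed.

Lemma gen_inj a b : a < n -> b < n -> gen a = gen b -> a = b.
Proof.
  intros Ha Hb E. apply (f_equal (@proj1_sig _ _)) in E.
  rewrite !gen_val in E by assumption. congruence.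
Qed.

Definition ev (im : nat -> W n) (u : list nat) : W n :=
  fold_right (fun a w => Wmul (im a) w) Wone u.

Definition hom (f : W n -> W n) : Prop := forall u v, f (Wmul u v) = Wmul (f u) (f v).

Lemma ev_gen (u : W n) : ev gen (proj1_sig u) = u.
Proof.
  apply W_ext. destruct u as [u Hu]. simpl. induction u as [|a u IH]; [reflexivity|].
  assert (Ha : a < n) by (apply (reduced_lt n (a :: u)); [assumption|now left]).
  apply Nat.ltb_lt in Ha. simpl. rewrite Ha. simpl.
  rewrite IH.
  - now apply (push_cons n).
  - simpl in Hu. now apply andb_true_iff in Hu as [_ Hu].
Qed.

Lemma hom_1 f : hom f -> f Wone = Wone.
Proof.
  intros H. set (u := f Wone).
  assert (E : Wmul u u = u) by (unfold u; rewrite <- H; now rewrite Wmul_1_l).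
  apply W_ext. simpl.
  assert (E' : mulw (proj1_sig u) (proj1_sig u) = proj1_sig u)
    by (apply (f_equal (@proj1_sig _ _)) in E; exact E).
  apply (f_equal (mulw (rev (proj1_sig u)))) in E'.
  assert (L : forall v, reducedb n v = true -> mulw (rev (proj1_sig u)) (mulw (proj1_sig u) v) = v).
  { intros v Hv. rewrite <- (rev_involutive (proj1_sig u)) at 2. apply (mulw_rev n); [|assumption].
    intros a Ha. apply in_rev in Ha. now apply W_lt in Ha. }
  rewrite L in E' by apply (proj2_sig u).
  rewrite <- (L [] eq_refl), (mulw_nil_r n _ (proj2_sig u)). exact E'.
Qed.

Lemma hom_ev f : hom f -> forall u, f u = ev (fun a => f (gen a)) (proj1_sig u).
Proof.
  intros H u. rewrite <- (ev_gen u) at 1. generalize (proj1_sig u) as l.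
  induction l as [|a l IH]; simpl; [now apply hom_1|]. now rewrite H, IH.
Qed.

Lemma hom_ext f g : hom f -> hom g -> (forall a, a < n -> f (gen a) = g (gen a)) -> f = g.
Proof.
  intros Hf Hg H. apply functional_extensionality. intros u.
  rewrite (hom_ev f Hf), (hom_ev g Hg).
  assert (L : forall a, In a (proj1_sig u) -> a < n) by apply W_lt.
  induction (proj1_sig u) as [|a l IH]; [reflexivity|].
  simpl. rewrite H, IH; auto using in_eq, in_cons.
Qed.

Definition ext (im : nat -> W n) (u : W n) : W n := ev im (proj1_sig u).

(** The universal property of a free product of groups of order two: only pairs of equal letters
    ever cancel. *)
Lemma ext_hom im : (forall a, a < n -> Wmul (im a) (im a) = Wone) -> hom (ext im).
Proof.
  intros H.
  assert (P : forall a v, a < n -> ev im (push a v) = Wmul (im a) (ev im v)).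
  { intros a [|b v] Ha; simpl; [reflexivity|]. destruct (Nat.eqb_spec a b) as [->|]; [|reflexivity].
    now rewrite <- Wmul_assoc, H, Wmul_1_l. }
  intros u v. unfold ext. simpl. fold (mulw (proj1_sig u) (proj1_sig v)).
  assert (L : forall a, In a (proj1_sig u) -> a < n) by apply W_lt.
  induction (proj1_sig u) as [|a l IH]; simpl; [now rewrite Wmul_1_l|].
  rewrite P by auto using in_eq. rewrite IH by auto using in_cons. now rewrite Wmul_assoc.
Qed.

Lemma ext_gen im a : a < n -> ext im (gen a) = im a.
Proof. intros H. unfold ext. rewrite gen_val by assumption. simpl. apply Wmul_1_r. Qed.

Lemma hom_id : hom (fun u => u).
Proof. intros u v. reflexivity. Qed.

Lemma hom_comp f g : hom f -> hom g -> hom (fun u => f (g u)).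
Proof. intros Hf Hg u v. now rewrite Hg, Hf. Qed.

Lemma involution_aut f : hom f -> (forall a, a < n -> f (f (gen a)) = gen a) ->
  is_aut f /\ (fun u => f (f u)) = (fun u => u).
Proof.
  intros Hf H.
  assert (E : (fun u => f (f u)) = (fun u => u)).
  { apply hom_ext; auto using hom_comp, hom_id. }
  split; [|assumption]. split; [assumption|].
  exists f. split; intros u; exact (f_equal (fun h => h u) E).
Qed.

Lemma aut_hom f : is_aut f -> hom f.
Proof. now intros [H _]. Qed.

Lemma aut_comp f g : is_aut f -> is_aut g -> @is_aut n (fun u => f (g u)).
Proof.
  intros [Hf [f' [Hf1 Hf2]]] [Hg [g' [Hg1 Hg2]]]. split; [now apply hom_comp|].
  exists (fun u => g' (f' u)). split; intros u.
  - now rewrite Hf1.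
  - now rewrite Hg2.
Qed.

Lemma aut_id : @is_aut n (fun u => u).
Proof. split; [apply hom_id|]. exists (fun u => u). auto. Qed.

Lemma aut_inv f : @is_aut n f -> exists g, is_aut g /\ (forall u, g (f u) = u) /\ (forall u, f (g u) = u).
Proof.
  intros [Hf [g [H1 H2]]]. exists g. split; [|auto]. split; [|now exists f].
  intros u v. rewrite <- (H2 u), <- (H2 v) at 1. now rewrite <- Hf, H1.
Qed.

Lemma aut_inj f u v : @is_aut n f -> f u = f v -> u = v.
Proof. intros [_ [g [H _]]] E. now rewrite <- (H u), E, H. Qed.

(** * Permutation automorphisms and partial conjugations *)

Definition permaut (p : nat -> nat) : W n -> W n := ext (fun a => gen (p a)).

Definition swap (a b c : nat) : nat :=
  if Nat.eqb c a then b else if Nat.eqb c b then a else c.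

Definition transp (a b : nat) : W n -> W n := permaut (swap a b).

Definition pconj (a b : nat) : W n -> W n :=
  ext (fun c => if Nat.eqb c a then Wmul (gen b) (Wmul (gen a) (gen b)) else gen c).

Lemma permaut_hom p : hom (permaut p).
Proof. apply ext_hom. intros. apply gen_sq. Qed.

Lemma permaut_gen p a : a < n -> permaut p (gen a) = gen (p a).
Proof. exact (ext_gen _ a). Qed.

Definition involutive_on (p : nat -> nat) : Prop := forall a, a < n -> p a < n /\ p (p a) = a.

Lemma swap_involutive a b : a < n -> b < n -> involutive_on (swap a b).
Proof.
  intros Ha Hb c Hc. unfold swap.
  destruct (Nat.eqb_spec c a), (Nat.eqb_spec c b); subst; split; auto;
  repeat match goal with |- context [Nat.eqb ?x ?y] => destruct (Nat.eqb_spec x y) end; congruence.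
Qed.

Lemma permaut_aut p : involutive_on p ->
  is_aut (permaut p) /\ (fun u => permaut p (permaut p u)) = (fun u => u).
Proof.
  intros Hp. apply involution_aut; [apply permaut_hom|]. intros a Ha.
  destruct (Hp a Ha) as [H1 H2]. now rewrite !permaut_gen, H2.
Qed.

Lemma transp_aut a b : a < n -> b < n ->
  is_aut (transp a b) /\ (fun u => transp a b (transp a b u)) = (fun u => u).
Proof. intros. now apply permaut_aut, swap_involutive. Qed.

Lemma pconj_hom a b : hom (pconj a b).
Proof.
  apply ext_hom. intros c Hc. destruct (Nat.eqb c a); [|apply gen_sq].
  now rewrite !Wmul_assoc, !gen_sq_l, gen_sq.
Qed.

Lemma pconj_gen_same a b : a < n -> pconj a b (gen a) = Wmul (gen b) (Wmul (gen a) (gen b)).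
Proof. intros H. unfold pconj. rewrite ext_gen by assumption. now rewrite Nat.eqb_refl. Qed.

Lemma pconj_gen_other a b c : c < n -> c <> a -> pconj a b (gen c) = gen c.
Proof.
  intros H H'. unfold pconj. rewrite ext_gen by assumption.
  apply Nat.eqb_neq in H'. now rewrite H'.
Qed.

Lemma pconj_aut a b : a < n -> b < n -> a <> b ->
  is_aut (pconj a b) /\ (fun u => pconj a b (pconj a b u)) = (fun u => u).
Proof.
  intros Ha Hb Hab. apply involution_aut; [apply pconj_hom|]. intros c Hc.
  destruct (Nat.eq_dec c a) as [->|E].
  - rewrite pconj_gen_same by assumption. rewrite !pconj_hom.
    rewrite pconj_gen_same, (pconj_gen_other a b b) by auto.
    now rewrite !Wmul_assoc, gen_sq, gen_sq_l, Wmul_1_r.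
  - rewrite !(pconj_gen_other a b c); auto.
Qed.

Lemma permaut_conj_pconj p a b : involutive_on p -> a < n -> b < n ->
  (fun u => permaut p (pconj a b u)) = (fun u => pconj (p a) (p b) (permaut p u)).
Proof.
  intros Hp Ha Hb. apply hom_ext.
  - apply hom_comp; [apply permaut_hom|apply pconj_hom].
  - apply hom_comp; [apply pconj_hom|apply permaut_hom].
  - intros c Hc. rewrite permaut_gen by assumption.
    destruct (Hp c Hc) as [Hc1 Hc2], (Hp a Ha) as [Ha1 Ha2].
    destruct (Nat.eq_dec c a) as [->|E].
    + rewrite !pconj_gen_same by assumption. rewrite !permaut_hom.
      now rewrite !permaut_gen.
    + rewrite !pconj_gen_other, permaut_gen; auto. intros E'. apply E. congruence.
Qed.

Lemma permaut_conj_transp p a b : involutive_on p -> a < n -> b < n ->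
  (fun u => permaut p (transp a b u)) = (fun u => transp (p a) (p b) (permaut p u)).
Proof.
  intros Hp Ha Hb. apply hom_ext.
  - apply hom_comp; apply permaut_hom.
  - apply hom_comp; apply permaut_hom.
  - intros c Hc. unfold transp.
    destruct (Hp c Hc) as [Hc1 Hc2], (Hp a Ha) as [Ha1 Ha2], (Hp b Hb) as [Hb1 Hb2].
    destruct (swap_involutive a b Ha Hb c Hc) as [Hs _].
    rewrite !permaut_gen by assumption. f_equal. unfold swap.
    destruct (Nat.eqb_spec c a) as [->|E1]; [now rewrite Nat.eqb_refl|].
    destruct (Nat.eqb_spec (p c) (p a)) as [E|_]; [congruence|].
    destruct (Nat.eqb_spec c b) as [->|E2]; [now rewrite Nat.eqb_refl|].
    destruct (Nat.eqb_spec (p c) (p b)) as [E|_]; congruence.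
Qed.

(** * Reducing an automorphism to a permutation of the generators *)

Definition word (f : W n -> W n) (a : nat) : list nat := proj1_sig (f (gen a)).

(* For [word f a = w c w^-1] this is [w c]. *)
Definition half (y : list nat) : list nat := firstn (S (Nat.div2 (length y))) y.

Lemma half_palindrome w c : half (w ++ c :: rev w) = w ++ [c].
Proof.
  unfold half. rewrite length_app. simpl length. rewrite length_rev.
  replace (length w + S (length w)) with (S (2 * length w)) by lia.
  rewrite Nat.div2_succ_double.
  rewrite firstn_app. replace (S (length w) - length w) with 1 by lia.
  rewrite firstn_all2 by lia. reflexivity.
Qed.

Lemma word_palindrome f a : is_aut f -> a < n -> exists w c, word f a = w ++ c :: rev w.
Proof.
  intros Hf Ha. apply (involution_palindrome n); [apply (proj2_sig (f (gen a)))| |].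
  - intros E. assert (E' : f (gen a) = f Wone).
    { apply W_ext. rewrite (hom_1 f (aut_hom f Hf)). exact E. }
    apply aut_inj in E'; [|assumption]. apply (f_equal (@proj1_sig _ _)) in E'.
    rewrite gen_val in E' by assumption. discriminate.
  - destruct Hf as [Hf _]. pose proof (Hf (gen a) (gen a)) as E. rewrite gen_sq, (hom_1 f Hf) in E.
    symmetry. exact (f_equal (@proj1_sig _ _) E).
Qed.

Lemma half_prefix f a : is_aut f -> a < n -> prefix (half (word f a)) (word f a).
Proof. intros. exists (skipn (S (Nat.div2 (length (word f a)))) (word f a)). symmetry. apply firstn_skipn. Qed.

Lemma hom_cons f a l (H : reducedb n (a :: l) = true) (H' : reducedb n l = true) :
  hom f -> proj1_sig (f (exist _ (a :: l) H)) = mulw (word f a) (proj1_sig (f (exist _ l H'))).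
Proof.
  intros Hf.
  assert (Ha : a < n) by (apply (reduced_lt n (a :: l)); [assumption|now left]).
  assert (E : exist _ (a :: l) H = Wmul (gen a) (exist _ l H')).
  { apply W_ext. change (a :: l = mulw (proj1_sig (gen a)) l). rewrite gen_val by assumption. simpl.
    symmetry. now apply (push_cons n). }
  rewrite E, Hf. reflexivity.
Qed.

(** A ping-pong argument. Incomparable prefixes define disjoint half-spaces, and [f (gen a)] is a
    reflection that throws the complement of its own half-space into it. *)
Lemma reduced_image_prefix f :
  is_aut f ->
  (forall a b, a < n -> b < n -> a <> b -> ~ prefix (half (word f b)) (half (word f a))) ->
  forall l a (H : reducedb n (a :: l) = true),
    prefix (half (word f a)) (proj1_sig (f (exist _ (a :: l) H))).
Proof.
  intros Hf N. induction l as [|b l IH]; intros a H;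
    assert (Ha : a < n) by (apply (reduced_lt n (a :: _) _ H); now left).
  - rewrite (hom_cons f a [] H eq_refl) by now apply aut_hom.
    assert (E : exist _ [] eq_refl = Wone) by now apply W_ext.
    rewrite E, (hom_1 f (aut_hom f Hf)). simpl.
    rewrite (mulw_nil_r n) by apply (proj2_sig (f (gen a))). now apply half_prefix.
  - assert (H' : reducedb n (b :: l) = true).
    { change (a :: b :: l) with ([a] ++ b :: l) in H. now apply reduced_app_r in H. }
    rewrite (hom_cons f a (b :: l) H H') by now apply aut_hom.
    specialize (IH b H').
    assert (Hb : b < n) by (apply (reduced_lt n (b :: l) _ H'); now left).
    assert (Hab : a <> b).
    { intros ->. simpl in H. rewrite Nat.eqb_refl in H. simpl in H. now rewrite andb_false_r in H. }
    assert (Hn : ~ prefix (half (word f a)) (proj1_sig (f (exist _ (b :: l) H')))).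
    { intros Hp. destruct (prefix_comparable _ _ _ Hp IH) as [Hc|Hc].
      - exact (N b a Hb Ha (not_eq_sym Hab) Hc).
      - exact (N a b Ha Hb Hab Hc). }
    destruct (word_palindrome f a Hf Ha) as (w & c & E).
    pose proof (proj2_sig (f (gen a))) as Hr. fold (word f a) in Hr.
    rewrite E, half_palindrome in *.
    apply (reflection_swaps_sides n); [exact Hr|apply (proj2_sig (f _))|exact Hn].
Qed.

(** If [f u = gen i] and [u] starts with [a], then [half (word f a)] is a prefix of the one-letter
    word [[i]]. This leaves no room for a conjugating word, so [f (gen a) = gen i]. *)
Lemma reduced_aut_permutes f :
  is_aut f ->
  (forall a b, a < n -> b < n -> a <> b -> ~ prefix (half (word f b)) (half (word f a))) ->
  forall i, i < n -> exists j, j < n /\ f (gen j) = gen i.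
Proof.
  intros Hf N i Hi. pose proof Hf as [Hh [g [Hg1 Hg2]]].
  destruct (g (gen i)) as [[|a l] H] eqn:E.
  - exfalso. pose proof (Hg2 (gen i)) as E'. rewrite E in E'.
    assert (E1 : exist _ [] H = Wone) by now apply W_ext.
    rewrite E1, (hom_1 f Hh) in E'. apply (f_equal (@proj1_sig _ _)) in E'.
    rewrite gen_val in E' by assumption. discriminate.
  - assert (Ha : a < n) by (apply (reduced_lt n (a :: l) _ H); now left).
    pose proof (reduced_image_prefix f Hf N l a H) as P. rewrite <- E, Hg2, gen_val in P by assumption.
    destruct (word_palindrome f a Hf Ha) as (w & c & Ew). rewrite Ew, half_palindrome in P.
    destruct P as [r P]. destruct w as [|b w]; simpl in P.
    + injection P as -> _. exists a. split; [assumption|]. apply W_ext.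
      rewrite gen_val by assumption. exact Ew.
    + injection P as _ P. now destruct w.
Qed.

(** With [wa = wb cb r], conjugating [wa ca wa^-1] by the reflection [wb cb wb^-1] gives
    [wb r ca r^-1 wb^-1], which saves at least two letters. *)
Lemma pconj_shortens f a b :
  is_aut f -> a < n -> b < n -> a <> b -> prefix (half (word f b)) (half (word f a)) ->
  length (word (fun u => f (pconj a b u)) a) < length (word f a).
Proof.
  intros Hf Ha Hb Hab [r Hr].
  destruct (word_palindrome f a Hf Ha) as (wa & ca & Ea).
  destruct (word_palindrome f b Hf Hb) as (wb & cb & Eb).
  rewrite Ea, Eb, !half_palindrome in Hr.
  assert (Ew : word (fun u => f (pconj a b u)) a = mulw (word f b) (mulw (word f a) (word f b))).
  { unfold word. rewrite pconj_gen_same by assumption. destruct Hf as [Hh _]. now rewrite !Hh. }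
  destruct r as [|c r _] using rev_ind.
  - exfalso. apply Hab. rewrite app_nil_r in Hr. apply app_inj_tail in Hr as [-> ->].
    rewrite <- Eb in Ea. apply gen_inj; [assumption..|]. apply (aut_inj f); [assumption|].
    now apply W_ext.
  - rewrite app_assoc in Hr. apply app_inj_tail in Hr as [Hw _].
    rewrite <- app_assoc in Hw. simpl in Hw.
    pose proof (proj2_sig (f (gen b))) as Rb. fold (word f b) in Rb.
    assert (Lb : forall x, In x wb -> x < n).
    { intros x Hx. apply (reduced_lt n (word f b)); [exact Rb|]. rewrite Eb.
      apply in_app_iff. now left. }
    assert (Lb' : forall x, In x (rev wb) -> x < n) by (intros x Hx; apply Lb; now apply in_rev).
    assert (Lc : Nat.ltb cb n = true).
    { apply Nat.ltb_lt. apply (reduced_lt n (word f b)); [exact Rb|]. rewrite Eb.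
      apply in_app_iff. right. now left. }
    assert (La : forall x, In x (wa ++ ca :: rev wa) -> x < n).
    { intros x Hx. apply (W_lt (f (gen a))). fold (word f a). now rewrite Ea. }
    set (M := r ++ ca :: rev r).
    assert (LM : forall x, In x M -> x < n).
    { intros x Hx. apply La. rewrite Hw. unfold M in Hx. rewrite rev_app_distr. simpl.
      rewrite !in_app_iff in *. simpl in *. rewrite !in_app_iff in *. simpl. tauto. }
    assert (RW : reducedb n (mulw (rev wb) []) = true) by (apply mulw_reduced; auto).
    assert (K : forall v, reducedb n v = true -> mulw (rev wb) (mulw wb v) = v).
    { intros v Hv. rewrite <- (rev_involutive wb) at 2. now apply (mulw_rev n). }
    assert (Z1 : mulw (word f a) (word f b) = mulw wb (push cb (mulw M (mulw (rev wb) [])))).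
    { rewrite <- (mulw_nil_r n (word f b) Rb), Ea, Eb.
      rewrite Hw. rewrite rev_app_distr. simpl rev.
      unfold M. repeat (rewrite ?mulw_app; simpl).
      rewrite K by (apply push_reduced; auto).
      now rewrite (push_push n) by assumption. }
    assert (RM : reducedb n (mulw M (mulw (rev wb) [])) = true) by (apply mulw_reduced; auto).
    rewrite Ew, Z1. rewrite Eb at 1. rewrite mulw_app. simpl mulw at 2.
    fold (mulw (rev wb) (mulw wb (push cb (mulw M (mulw (rev wb) []))))).
    rewrite K by (apply push_reduced; auto).
    rewrite (push_push n) by assumption.
    pose proof (mulw_length wb (mulw M (mulw (rev wb) []))) as L1.
    pose proof (mulw_length M (mulw (rev wb) [])) as L2.
    pose proof (mulw_length (rev wb) []) as L3.
    rewrite Ea, Hw. unfold M in *. rewrite !length_app in *. simpl in *. rewrite !length_rev in *.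
    rewrite !length_app in *. simpl in *. lia.
Qed.

Definition size (f : W n -> W n) : nat := list_sum (map (fun a => length (word f a)) (seq 0 n)).

Lemma list_sum_lt (f g : nat -> nat) l a :
  In a l -> f a < g a -> (forall x, In x l -> f x <= g x) -> list_sum (map f l) < list_sum (map g l).
Proof.
  intros Ha Hlt Hle.
  assert (Hs : forall l, (forall x, In x l -> f x <= g x) -> list_sum (map f l) <= list_sum (map g l)).
  { clear. induction l as [|x l IH]; simpl; intros H; [lia|].
    specialize (IH (fun y Hy => H y (or_intror Hy))). specialize (H x (or_introl eq_refl)). lia. }
  induction l as [|x l IH]; simpl in *; [contradiction|].
  destruct Ha as [->|Ha].
  - specialize (Hs l (fun y Hy => Hle y (or_intror Hy))). lia.
  - specialize (IH Ha (fun y Hy => Hle y (or_intror Hy))). specialize (Hle x (or_introl eq_refl)). lia.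
Qed.

Definition permutes_gens (f : W n -> W n) : Prop :=
  forall i, i < n -> exists j, j < n /\ f (gen i) = gen j.

(** Descent on the total length of the images of the generators: partial conjugations shorten it
    until the prefixes are incomparable. *)
Lemma aut_generated (P : (W n -> W n) -> Prop) :
  (forall f g, is_aut f -> is_aut g -> P f -> P g -> P (fun u => f (g u))) ->
  (forall f g, is_aut f -> is_aut g -> (forall u, f (g u) = u) -> P g -> P f) ->
  (forall f, is_aut f -> permutes_gens f -> P f) ->
  (forall a b, a < n -> b < n -> a <> b -> P (pconj a b)) ->
  forall f, is_aut f -> P f.
Proof.
  intros Pcomp Pinv Pperm Pconj f. remember (size f) as m eqn:Hm. revert f Hm.
  induction m as [m IH] using lt_wf_ind. intros f Hm Hf.
  destruct (classic (exists a b, a < n /\ b < n /\ a <> b /\ prefix (half (word f b)) (half (word f a))))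
    as [(a & b & Ha & Hb & Hab & Hp)|HN].
  - destruct (pconj_aut a b Ha Hb Hab) as [Ac Ic].
    set (g := fun u => f (pconj a b u)).
    assert (Ag : is_aut g) by exact (aut_comp f (pconj a b) Hf Ac).
    assert (Pg : P g).
    { apply (IH (size g)); auto. rewrite Hm. apply (list_sum_lt _ _ _ a).
      - apply in_seq. lia.
      - now apply pconj_shortens.
      - intros c Hc. apply in_seq in Hc. destruct (Nat.eq_dec c a) as [->|E].
        + apply Nat.lt_le_incl. now apply pconj_shortens.
        + unfold g, word. rewrite pconj_gen_other by (auto; lia). auto. }
    assert (E : f = fun u => g (pconj a b u)).
    { apply functional_extensionality. intros u. unfold g.
      now rewrite (f_equal (fun h => h u) Ic : pconj a b (pconj a b u) = u). }
    rewrite E. apply (Pcomp g (pconj a b)); auto.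
  (* [reduced_aut_permutes] finds preimages of generators, so it is the inverse that is seen to
     permute them. *)
  - destruct (aut_inv f Hf) as (g & Ag & Hg1 & Hg2).
    apply (Pinv f g Hf Ag Hg2). apply Pperm; [assumption|]. intros i Hi.
    destruct (reduced_aut_permutes f Hf) with (i := i) as [j [Hj E]]; [|assumption|].
    + intros a b Ha Hb Hab Hp. apply HN. now exists a, b.
    + exists j. split; [assumption|]. now rewrite <- E, Hg1.
Qed.

(** One letter at a time: if [f] fixes the letters above [m], a transposition applied after [f]
    makes it fix [m] as well. *)
Lemma permutation_generated (P : (W n -> W n) -> Prop) :
  (forall f g, is_aut f -> is_aut g -> P f -> P g -> P (fun u => f (g u))) ->
  P (fun u => u) ->
  (forall a b, a < n -> b < n -> P (transp a b)) ->
  forall f, is_aut f -> permutes_gens f -> P f.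
Proof.
  intros Pcomp Pid Ptr f Hf Hp.
  assert (G : forall m f, is_aut f -> permutes_gens f ->
    (forall c, m <= c < n -> f (gen c) = gen c) -> m <= n -> P f).
  { clear f Hf Hp. induction m as [|m IH]; intros f Hf Hp Hfix Hm.
    - replace f with (fun u : W n => u); [assumption|]. apply hom_ext; [apply hom_id|now apply aut_hom|].
      intros a Ha. symmetry. apply Hfix. lia.
    - destruct (Hp m Hm) as [j [Hj E]].
      destruct (transp_aut j m Hj Hm) as [At It].
      set (g := fun u => transp j m (f u)).
      assert (Ag : is_aut g) by exact (aut_comp (transp j m) f At Hf).
      assert (Hjm : j <= m).
      { apply Nat.le_ngt. intros Hlt. rewrite <- (Hfix j) in E by lia.
        apply aut_inj in E; [|assumption]. apply gen_inj in E; lia. }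
      assert (Pg : P g).
      { apply IH; auto; [| |lia].
        - intros i Hi. destruct (Hp i Hi) as [i' [Hi' Ei]].
          exists (swap j m i'). split; [now apply swap_involutive|]. unfold g, transp.
          now rewrite Ei, permaut_gen.
        - intros c Hc. unfold g, transp. destruct (Nat.eq_dec c m) as [->|Hcm].
          + rewrite E, permaut_gen by assumption. unfold swap. now rewrite Nat.eqb_refl.
          + rewrite Hfix, permaut_gen by lia. unfold swap.
            destruct (Nat.eqb_spec c j); [lia|]. destruct (Nat.eqb_spec c m); [lia|reflexivity]. }
      assert (Ef : f = fun u => transp j m (g u)).
      { apply functional_extensionality. intros u. unfold g.
        now rewrite (f_equal (fun h => h (f u)) It : transp j m (transp j m (f u)) = f u). }
      rewrite Ef. apply (Pcomp (transp j m) g); auto. }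
  apply (G n); auto. intros; lia.
Qed.

End Universal.

(** * Fixed points of the automorphism group *)

(* [s_gen off 0], ..., [s_gen off (k - 1)] generate the copy of Aut(W_k)
   permuting and conjugating the letters [off], ..., [off + k - 1]. *)
Definition s_gen {n : nat} (off i : nat) : W n -> W n :=
  match i with
  | O => pconj (S off) off
  | S j => transp (off + j) (off + S j)
  end.

Lemma s_gen_aut n off i : off + Nat.max 1 i < n ->
  is_aut (@s_gen n off i) /\ (fun u => @s_gen n off i (s_gen off i u)) = (fun u => u).
Proof.
  intros H. destruct i as [|j]; simpl in *.
  - apply pconj_aut; lia.
  - apply transp_aut; lia.
Qed.

(** Besides moving only two letters, [f] sends them to products of these two. This is phrased
    without words: homomorphisms that fix both letters also fix their images. *)
Definition supported {n} (f : W n -> W n) (a b : nat) : Prop :=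
  (forall c, c < n -> c <> a -> c <> b -> f (gen c) = gen c) /\
  forall g, hom g -> g (gen a) = gen a -> g (gen b) = gen b ->
    g (f (gen a)) = f (gen a) /\ g (f (gen b)) = f (gen b).

(** [pred i] and [Nat.max 1 i] unite the partial conjugation [i = 0] with the first transposition
    [i = 1], which involves the same letters [off] and [off + 1]. *)
Lemma s_gen_supported n off i : off + Nat.max 1 i < n ->
  supported (@s_gen n off i) (off + pred i) (off + Nat.max 1 i).
Proof.
  intros H. destruct i as [|j].
  - simpl. rewrite Nat.add_0_r. split.
    + intros c Hc H1 H2. apply pconj_gen_other; lia.
    + intros g Hg H1 H2. replace (off + 1) with (S off) in * by lia. simpl in H.
      rewrite pconj_gen_same, pconj_gen_other by lia. rewrite !Hg, H1, H2. auto.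
  - replace (Nat.max 1 (S j)) with (S j) in * by lia. simpl pred. split.
    + intros c Hc H1 H2. simpl. unfold transp. rewrite permaut_gen by assumption. unfold swap.
      destruct (Nat.eqb_spec c (off + j)); [lia|]. destruct (Nat.eqb_spec c (off + S j)); [lia|reflexivity].
    + intros g Hg H1 H2. simpl. unfold transp. rewrite !permaut_gen by lia. unfold swap.
      rewrite !Nat.eqb_refl. destruct (Nat.eqb_spec (off + S j) (off + j)); [lia|]. auto.
Qed.

Lemma s_gen_commute n off i off' j :
  off + Nat.max 1 i < off' + pred j -> off' + Nat.max 1 j < n ->
  (fun u => @s_gen n off i (s_gen off' j u)) = (fun u => s_gen off' j (s_gen off i u)).
Proof.
  intros H H'.
  assert (H1 : off + Nat.max 1 i < n) by lia.
  destruct (s_gen_supported n off i H1) as [F1 F2].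
  destruct (s_gen_supported n off' j H') as [G1 G2].
  pose proof (aut_hom _ (proj1 (s_gen_aut n off i H1))) as Hf.
  pose proof (aut_hom _ (proj1 (s_gen_aut n off' j H'))) as Hg.
  apply hom_ext; [now apply hom_comp..|]. intros c Hc.
  destruct (F2 _ Hg) as [F3 F4]; [apply G1; lia..|].
  destruct (G2 _ Hf) as [G3 G4]; [apply F1; lia..|].
  destruct (Nat.eq_dec c (off + pred i)) as [->|E1].
  { rewrite F3, G1 by lia. reflexivity. }
  destruct (Nat.eq_dec c (off + Nat.max 1 i)) as [->|E2].
  { rewrite F4, G1 by lia. reflexivity. }
  rewrite (F1 c) by assumption.
  destruct (Nat.eq_dec c (off' + pred j)) as [->|E3]; [exact G3|].
  destruct (Nat.eq_dec c (off' + Nat.max 1 j)) as [->|E4]; [exact G4|].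
  rewrite (G1 c) by assumption. now apply F1.
Qed.

Lemma permaut_conj_s_gen n p off off' k i :
  involutive_on (n := n) p -> off + k <= n -> 2 <= k -> i < k ->
  (forall j, j < k -> p (off + j) = off' + j) ->
  (fun u => permaut p (@s_gen n off i u)) = (fun u => s_gen off' i (permaut p u)).
Proof.
  intros Hp Hk H2 Hi Hj. destruct i as [|i]; simpl.
  - rewrite permaut_conj_pconj by (auto; lia).
    pose proof (Hj 0 ltac:(lia)) as E0. pose proof (Hj 1 ltac:(lia)) as E1.
    rewrite !Nat.add_0_r in E0. rewrite !Nat.add_1_r in E1. now rewrite E0, E1.
  - rewrite permaut_conj_transp by (auto; lia). now rewrite !Hj by lia.
Qed.

(** An exchange of two blocks rather than a shift, because it is an involution and [permaut_aut]
    treats involutions. *)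
Definition block_swap (k off c : nat) : nat :=
  if Nat.ltb c k then c + off
  else if Nat.leb off c && Nat.ltb c (off + k) then c - off else c.

Lemma block_swap_involutive n k off :
  k <= off -> off + k <= n -> involutive_on (n := n) (block_swap k off).
Proof.
  intros H1 H2 c Hc. unfold block_swap. split;
    destruct (Nat.ltb_spec c k); [lia| |destruct (Nat.ltb_spec (c + off) k); [lia|]|];
    destruct (Nat.leb_spec off c), (Nat.ltb_spec c (off + k)); cbn [andb]; try lia.
  all: try (destruct (Nat.leb_spec off (c + off)), (Nat.ltb_spec (c + off) (off + k));
    cbn [andb]; lia).
  - destruct (Nat.ltb_spec (c - off) k); lia.
  - destruct (Nat.ltb_spec c k), (Nat.leb_spec off c), (Nat.ltb_spec c (off + k)); cbn [andb]; lia.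
  - destruct (Nat.ltb_spec c k), (Nat.leb_spec off c), (Nat.ltb_spec c (off + k)); cbn [andb]; lia.
Qed.

Section Action.

Context {n : nat} {X : Type} (dist : X -> X -> R)
  (Hmet : is_metric dist) (Hcomp : complete dist) (Hcat : CAT0 dist) (o : X)
  (act : (W n -> W n) -> X -> X) (Hact : isometric_Aut_action dist act).

Lemma act_id x : act (fun u => u) x = x.
Proof. apply Hact. Qed.

Lemma act_comp f g x : is_aut f -> is_aut g -> act (fun u => f (g u)) x = act f (act g x).
Proof. destruct Hact as (_ & H & _). auto. Qed.

Lemma act_isom f x y : is_aut f -> dist (act f x) (act f y) = dist x y.
Proof. destruct Hact as (_ & _ & H). auto. Qed.

(** An automorphism is determined by its values on the [n] generators, so only finitely many can
    have these values in [T]. *)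
Lemma finite_orbit_bounded (H : (W n -> W n) -> Prop) (T : list (W n)) :
  (forall h, H h -> is_aut h /\ forall c, c < n -> In (h (gen c)) T) ->
  exists B, forall h, H h -> (dist o (act h o) <= B)%R.
Proof.
  intros HT.
  set (key := fun h : W n -> W n => map (fun c => h (gen c)) (seq 0 n)).
  destruct (uniform_bound (tuples T n) (fun t B => forall h, H h -> key h = t -> (dist o (act h o) <= B)%R))
    as [B [_ HB]].
  - intros t r r' Hr Hle h Hh E. eapply Rle_trans; [now apply Hr|assumption].
  - intros t _. destruct (classic (exists h, H h /\ key h = t)) as [[h [Hh Eh]]|Hno].
    + exists (dist o (act h o)). intros h' Hh' Eh'. right. f_equal. f_equal.
      apply hom_ext; [apply aut_hom; now apply HT..|]. intros a Ha.
      rewrite <- Eh in Eh'. unfold key in Eh'.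
      pose proof (ext_in_map Eh' a) as E. apply E. apply in_seq. lia.
    + exists 0%R. intros h Hh Eh. exfalso. apply Hno. now exists h.
  - exists B. intros h Hh. apply (HB (key h)); auto.
    apply in_tuples; [unfold key; now rewrite length_map, length_seq|]. intros x Hx. apply in_map_iff in Hx as [c [<- Hc]]. apply in_seq in Hc.
    apply HT; [assumption|lia].
Qed.

(** The fixed point is the centre of the set of all [act h o]. [H] only has to be stable under the
    involutions in [G], so no finite group has to be constructed. *)
Lemma finite_fixed_point (H G : (W n -> W n) -> Prop) (T : list (W n)) :
  (forall h, H h -> is_aut h /\ forall c, c < n -> In (h (gen c)) T) ->
  H (fun u => u) ->
  (forall g, G g -> is_aut g /\ (fun u => g (g u)) = (fun u => u)) ->
  (forall g h, G g -> H h -> H (fun u => g (h u))) ->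
  exists x, forall g, G g -> act g x = x.
Proof.
  intros HT H1 HG HGH. destruct (finite_orbit_bounded H T HT) as [B HB].
  destruct (relative_centre dist Hmet Hcomp Hcat (fun _ => True) (fun s => exists h, H h /\ s = act h o) o B)
    as [c [_ Hc]].
  - apply closed_all.
  - apply convex_all.
  - now exists o.
  - exists (fun u => u). now rewrite act_id.
  - intros s [h [Hh ->]]. auto.
  - exists c. intros g Hg. destruct (HG g Hg) as [Ag Ig]. apply Hc.
    + intros. now apply act_isom.
    + intros s [h [Hh ->]]. exists (act (fun u => g (h u)) o). split.
      * exists (fun u => g (h u)). auto.
      * rewrite <- (act_comp g (fun u => g (h u))).
        -- f_equal. apply functional_extensionality. intros u.
           exact (f_equal (fun k => k (h u)) Ig).
        -- assumption.
        -- apply HT. auto.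
    + trivial.
Qed.

Lemma transps_fixed_point : exists x, forall a b, a < n -> b < n -> act (transp a b) x = x.
Proof.
  destruct (finite_fixed_point (fun h => is_aut h /\ permutes_gens h)
     (fun g => exists a b, a < n /\ b < n /\ g = transp a b) (map gen (seq 0 n))) as [x Hx].
  - intros h [Ah Ph]. split; [assumption|]. intros c Hc. destruct (Ph c Hc) as [j [Hj ->]].
    apply in_map, in_seq. lia.
  - split; [apply aut_id|]. intros i Hi. now exists i.
  - intros g (a & b & Ha & Hb & ->). now apply transp_aut.
  - intros g h (a & b & Ha & Hb & ->) [Ah Ph]. split.
    + apply (aut_comp (transp a b) h); [now apply transp_aut|assumption].
    + intros i Hi. destruct (Ph i Hi) as [j [Hj ->]].
      exists (swap a b j). split; [now apply swap_involutive|]. now apply permaut_gen.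
  - exists x. intros a b Ha Hb. apply Hx. now exists a, b.
Qed.

(* The partial conjugations by one letter commute, and together with the
   permutations fixing that letter they generate a finite group. *)
Lemma star_fixed_point off : off < n ->
  exists x, (forall a, a < n -> a <> off -> act (pconj a off) x = x) /\
    forall a b, a < n -> b < n -> a <> off -> b <> off -> act (transp a b) x = x.
Proof.
  intros Hoff.
  set (cj := fun c => Wmul (gen off) (Wmul (gen c) (gen off)) : W n).
  (* The finite set: each generator goes to a generator or to the conjugate of one by the letter
     [off]. It is stable because a second conjugation by [off] undoes the first. *)
  destruct (finite_fixed_point
     (fun h => is_aut h /\ forall c, c < n -> exists j, j < n /\ (h (gen c) = gen j \/ h (gen c) = cj j))
     (fun g => (exists a, a < n /\ a <> off /\ g = pconj a off) \/
        exists a b, a < n /\ b < n /\ a <> off /\ b <> off /\ g = transp a b)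
     (map gen (seq 0 n) ++ map cj (seq 0 n))) as [x Hx].
  - intros h [Ah Ph]. split; [assumption|]. intros c Hc. destruct (Ph c Hc) as [j [Hj E]].
    apply in_app_iff. destruct E as [->| ->]; [left|right]; apply in_map, in_seq; lia.
  - split; [apply aut_id|]. intros i Hi. exists i. auto.
  - intros g [(a & Ha & Hn & ->)|(a & b & Ha & Hb & _ & _ & ->)]; [now apply pconj_aut|now apply transp_aut].
  - intros g h Hg [Ah Ph].
    assert (P : is_aut g /\ g (gen off) = gen off /\
      forall c, c < n -> exists j, j < n /\ (g (gen c) = gen j \/ g (gen c) = cj j)).
    { destruct Hg as [(a & Ha & Hn & ->)|(a & b & Ha & Hb & Hna & Hnb & ->)].
      - split; [now apply pconj_aut|]. split; [apply pconj_gen_other; auto|].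
        intros c Hc. exists c. split; [assumption|]. destruct (Nat.eq_dec c a) as [->|E].
        + right. now apply pconj_gen_same.
        + left. now apply pconj_gen_other.
      - split; [now apply transp_aut|]. split.
        + unfold transp. rewrite permaut_gen by assumption. unfold swap.
          destruct (Nat.eqb_spec off a); [congruence|]. destruct (Nat.eqb_spec off b); congruence.
        + intros c Hc. exists (swap a b c). split; [now apply swap_involutive|].
          left. now apply permaut_gen. }
    destruct P as (Ag & Eg & Pg). split; [now apply (aut_comp g h)|].
    intros c Hc. destruct (Ph c Hc) as [j [Hj E]]. destruct (Pg j Hj) as [j' [Hj' E']].
    exists j'. split; [assumption|].
    assert (Ecj : g (cj j) = Wmul (gen off) (Wmul (g (gen j)) (gen off))).
    { unfold cj. rewrite !(aut_hom g Ag). now rewrite Eg. }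
    destruct E as [->| ->].
    + destruct E' as [->| ->]; auto.
    + rewrite Ecj. destruct E' as [->| ->]; [now right|left].
      unfold cj. now rewrite !Wmul_assoc, gen_sq, gen_sq_l, Wmul_1_r.
  - exists x. split.
    + intros a Ha Hn. apply Hx. left. now exists a.
    + intros a b Ha Hb Hna Hnb. apply Hx. right. now exists a, b.
Qed.

(** * Induction on the rank of a block *)

Definition block_fixed (k off : nat) : Prop :=
  exists x, forall i, i < k -> act (s_gen off i) x = x.

Lemma block_fixed_move k off off' p :
  involutive_on (n := n) p -> off + k <= n -> off' + k <= n -> 2 <= k ->
  (forall j, j < k -> p (off + j) = off' + j) -> block_fixed k off -> block_fixed k off'.
Proof.
  intros Hp H1 H2 Hk Hj [x Hx]. exists (act (permaut p) x). intros i Hi.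
  destruct (permaut_aut p Hp) as [Ap _].
  rewrite <- act_comp; [|apply s_gen_aut; lia|assumption].
  rewrite <- (permaut_conj_s_gen n p off off' k i) by assumption.
  rewrite act_comp; [|assumption|apply s_gen_aut; lia]. now rewrite Hx.
Qed.

Lemma commuting_fixed {I J : Type} (P : I -> Prop) (Q : J -> Prop)
  (f : I -> W n -> W n) (g : J -> W n -> W n) :
  (forall i, P i -> is_aut (f i)) -> (forall j, Q j -> is_aut (g j)) ->
  (forall i j, P i -> Q j -> (fun u => f i (g j u)) = (fun u => g j (f i u))) ->
  (exists x, forall i, P i -> act (f i) x = x) -> (exists x, forall j, Q j -> act (g j) x = x) ->
  exists x, (forall i, P i -> act (f i) x = x) /\ (forall j, Q j -> act (g j) x = x).
Proof.
  intros Af Ag Hc [x Hx] [y Hy].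
  destruct (commuting_fixed_point dist Hmet Hcomp Hcat
     (fun h => exists i, P i /\ h = act (f i)) (fun h => exists j, Q j /\ h = act (g j))) as [z [Hz1 Hz2]].
  - intros a [i [Hi ->]] u v. apply act_isom. auto.
  - intros a [i [Hi ->]] u v. apply act_isom. auto.
  - intros a b u [i [Hi ->]] [j [Hj ->]]. rewrite <- !act_comp by auto. now rewrite Hc.
  - exists x. intros a [i [Hi ->]]. auto.
  - exists y. intros b [j [Hj ->]]. auto.
  - exists z. split; [intros i Hi; apply Hz1; now exists i|intros j Hj; apply Hz2; now exists j].
Qed.

(** For [m = 0] only permutations remain. For [m = 1] no remaining transposition moves the letter
    [off], as in [star_fixed_point]. For larger [m] the generators below [m] form a smaller block
    and commute with the transpositions above [m]. *)
Lemma block_minus_one_fixed k off m :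
  2 <= k -> off + k <= n -> m < k -> (forall j, 2 <= j < k -> block_fixed j off) ->
  exists x, forall b, b < k -> b <> m -> act (s_gen off b) x = x.
Proof.
  intros Hk Hoff Hm IH. destruct m as [|[|m]].
  - destruct transps_fixed_point as [x Hx]. exists x.
    intros [|b] Hb Hn; [congruence|]. apply Hx; lia.
  - destruct (star_fixed_point off) as [x [H1 H2]]; [lia|]. exists x.
    intros [|[|b]] Hb Hn; [apply H1; lia|congruence|apply H2; lia].
  - destruct (commuting_fixed (fun i => i < S (S m)) (fun j => S (S m) < j < k) (s_gen off) (s_gen off))
      as [x [H1 H2]].
    + intros i Hi. apply s_gen_aut. lia.
    + intros i Hi. apply s_gen_aut. lia.
    + intros i j Hi Hj. apply s_gen_commute; lia.
    + apply (IH (S (S m))). lia.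
    + destruct transps_fixed_point as [x Hx]. exists x. intros [|j] Hj; [lia|]. apply Hx; lia.
    + exists x. intros b Hb Hn. destruct (Nat.lt_ge_cases b (S (S m))); [now apply H1|apply H2; lia].
Qed.

Lemma blocks_minus_one_fixed k q (a : nat -> nat) :
  2 <= k -> q * k <= n -> (forall i, i < q -> a i < k) ->
  (forall i j, i < q -> 2 <= j < k -> block_fixed j (i * k)) ->
  exists x, forall i b, i < q -> b < k -> b <> a i -> act (s_gen (i * k) b) x = x.
Proof.
  intros Hk Hq Ha IH. induction q as [|q IHq].
  - exists o. lia.
  - destruct (commuting_fixed (fun ib => fst ib < q /\ snd ib < k /\ snd ib <> a (fst ib))
      (fun b => b < k /\ b <> a q) (fun ib => s_gen (fst ib * k) (snd ib)) (s_gen (q * k)))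
      as [x [H1 H2]].
    + intros [i b] (Hi & Hb & _). simpl in *. apply s_gen_aut. nia.
    + intros b [Hb _]. apply s_gen_aut. nia.
    + intros [i b] c (Hi & Hb & _) [Hc _]. simpl in *. apply s_gen_commute; nia.
    + destruct IHq as [x Hx]; [nia|intros; apply Ha; lia|intros; apply IH; lia|].
      exists x. intros [i b] (Hi & Hb & Hn). simpl in *. auto.
    + destruct (block_minus_one_fixed k (q * k) (a q)) as [x Hx]; [assumption|nia|apply Ha; lia| |].
      * intros j Hj. apply IH; lia.
      * exists x. intros b [Hb Hn]. auto.
    + exists x. intros i b Hi Hb Hn. destruct (Nat.eq_dec i q) as [->|E]; [now apply H2|].
      apply (H1 (i, b)). simpl. repeat split; auto. lia.
Qed.

(** With [q = n / k] one has [n <= q k + k - 1], so it suffices that [q (k - 2) >= k - 1], which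
    holds for [q >= 2] and [k >= 3]. For [k = 2] there is equality with [n / 2], and for [q = 1] one
    has [n <= 2 k - 1]. *)
Lemma copies_exceed_dimension k d : 2 <= k <= n -> d < n / 2 -> d < n / k * (k - 1).
Proof.
  intros Hk Hd. apply Nat.lt_le_trans with (n / 2); [assumption|].
  pose proof (Nat.div_mod n 2 ltac:(lia)) as E2. pose proof (Nat.mod_upper_bound n 2 ltac:(lia)).
  pose proof (Nat.div_mod n k ltac:(lia)) as Ek. pose proof (Nat.mod_upper_bound n k ltac:(lia)).
  set (h := n / 2) in *. set (q := n / k) in *.
  assert (Hq : 1 <= q) by (destruct q; lia).
  destruct (Nat.eq_dec k 2) as [->|]; [lia|].
  destruct (Nat.eq_dec q 1) as [->|]; [lia|]. nia.
Qed.

Lemma all_blocks_fixed d k :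
  covdim_le dist d -> d < n / 2 -> 2 <= k <= n -> block_fixed k 0.
Proof.
  intros Hdim Hd. induction k as [k IH] using lt_wf_ind. intros Hk.
  set (q := n / k).
  assert (Hqk : q * k <= n) by (unfold q; rewrite Nat.mul_comm; apply Nat.Div0.mul_div_le).
  (* The induction hypothesis speaks of offset 0; an exchange of two blocks of letters carries it to
     the other offsets. *)
  assert (IH' : forall i j, i < q -> 2 <= j < k -> block_fixed j (i * k)).
  { intros i j Hi Hj. destruct i as [|i]; [apply IH; lia|].
    apply (block_fixed_move j 0 (S i * k) (block_swap j (S i * k))); try nia.
    - apply block_swap_involutive; nia.
    - intros c Hc. unfold block_swap. simpl (0 + c). apply Nat.ltb_lt in Hc. rewrite Hc. lia.
    - apply IH; lia. }
  assert (Iso : forall i b, i < q -> b < k -> forall x y,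
      dist (act (s_gen (i * k) b) x) (act (s_gen (i * k) b) y) = dist x y).
  { intros i b Hi Hb x y. apply act_isom, s_gen_aut. nia. }
  destruct (product_helly dist Hmet Hcomp Hcat o q k (fun i b x => act (s_gen (i * k) b) x = x))
    with (d := d) as [i [Hi [x Hx]]].
  - intros i b Hi Hb. apply fix_convex; auto.
  - intros a Ha. apply blocks_minus_one_fixed; auto. lia.
  - assumption.
  - now apply copies_exceed_dimension.
  - intros i b Hi Hb. apply fix_closed; auto.
  (* The Helly theorem does not tell which copy has the fixed point; it is moved back to offset
     0. *)
  - destruct i as [|i]; [exists x; exact Hx|].
    apply (block_fixed_move k (S i * k) 0 (block_swap k (S i * k))); try nia.
    + apply block_swap_involutive; nia.
    + intros c Hc. unfold block_swap.
      destruct (Nat.ltb_spec (S i * k + c) k); [nia|].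
      destruct (Nat.leb_spec (S i * k) (S i * k + c)); [|lia].
      destruct (Nat.ltb_spec (S i * k + c) (S i * k + k)); [simpl; lia|lia].
    + now exists x.
Qed.

Lemma fixed_by_all_automorphisms x :
  3 <= n -> (forall i, i < n -> act (s_gen 0 i) x = x) -> forall f, is_aut f -> act f x = x.
Proof.
  intros Hn Hx.
  assert (Hcomp' : forall f g, is_aut f -> is_aut g -> act f x = x -> act g x = x ->
    act (fun u => f (g u)) x = x).
  { intros f g Af Ag Ef Eg. rewrite act_comp by assumption. now rewrite Eg. }
  assert (Hconj : forall p f g, involutive_on (n := n) p -> is_aut f -> is_aut g ->
    (fun u => permaut p (f u)) = (fun u => g (permaut p u)) ->
    act (permaut p) x = x -> act f x = x -> act g x = x).
  { intros p f g Hp Af Ag E Ep Ef. destruct (permaut_aut p Hp) as [Ap _].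
    rewrite <- Ep at 1. rewrite <- act_comp, <- E, act_comp by assumption. now rewrite Ef. }
  (* The transposition of [a] and [a + m + 2] is that of [a] and [a + m + 1], conjugated by an
     adjacent one. *)
  assert (Htr : forall m a, a + S m < n -> act (transp a (a + S m)) x = x).
  { induction m as [|m IHm]; intros a Ha.
    - rewrite Nat.add_1_r. apply (Hx (S a)). lia.
    - pose proof (Hx (S (a + S m)) ltac:(lia)) as Ht. simpl in Ht.
      replace (transp a (a + S (S m))) with (@transp n (swap (a + S m) (S (a + S m)) a) (swap (a + S m) (S (a + S m)) (a + S m))).
      + apply (Hconj (swap (a + S m) (S (a + S m))) (transp a (a + S m))).
        * apply swap_involutive; lia.
        * apply transp_aut; lia.
        * apply transp_aut; apply swap_involutive; lia.
        * apply permaut_conj_transp; [apply swap_involutive; lia|lia..].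
        * exact Ht.
        * apply IHm. lia.
      + unfold swap. rewrite !Nat.eqb_refl.
        destruct (Nat.eqb_spec a (a + S m)); [lia|]. destruct (Nat.eqb_spec a (S (a + S m))); [lia|].
        f_equal. lia. }
  assert (Hperm : forall f, is_aut f -> permutes_gens f -> act f x = x).
  { apply permutation_generated.
    - assumption.
    - apply act_id.
    - intros a b Ha Hb. destruct (lt_eq_lt_dec a b) as [[E| ->]|E].
      + replace b with (a + S (b - a - 1)) by lia. apply Htr. lia.
      + replace (transp b b) with (fun u : W n => u); [apply act_id|].
        apply hom_ext; [apply hom_id|apply permaut_hom|]. intros c Hc. unfold transp.
        rewrite permaut_gen by assumption. unfold swap. now destruct (Nat.eqb_spec c b) as [->|].
      + replace (transp a b) with (@transp n b a).
        * replace a with (b + S (a - b - 1)) by lia. apply Htr. lia.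
        * apply hom_ext; [apply permaut_hom..|]. intros c Hc. unfold transp.
          rewrite !permaut_gen by assumption. unfold swap.
          destruct (Nat.eqb_spec c a), (Nat.eqb_spec c b); congruence. }
  assert (Hswap : forall a b, a < n -> b < n -> act (permaut (swap a b)) x = x).
  { intros a b Ha Hb. apply Hperm; [now apply permaut_aut, swap_involutive|].
    intros i Hi. exists (swap a b i). split; [now apply swap_involutive|]. now apply permaut_gen. }
  assert (Hstep : forall a b c e, a < n -> b < n -> c < n -> e < n -> a <> b ->
     act (pconj a b) x = x -> act (pconj (swap c e a) (swap c e b)) x = x).
  { intros a b c e Ha Hb Hc He Hab E.
    pose proof (swap_involutive c e Hc He) as Hs.
    apply (Hconj (swap c e) (pconj a b)); auto.
    - now apply pconj_aut.
    - destruct (Hs a Ha), (Hs b Hb). apply pconj_aut; auto. congruence.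
    - now apply permaut_conj_pconj. }
  apply aut_generated; [assumption| |assumption|].
  - intros f g Af Ag E Eg. rewrite <- Eg at 1. rewrite <- act_comp by assumption.
    replace (fun u => f (g u)) with (fun u : W n => u); [apply act_id|].
    apply functional_extensionality. intros u. now rewrite E.
  - intros a b Ha Hb Hab.
    (* Two transpositions move [pconj 1 0] to [pconj a b]: exchanging 0 and [b] places the
       conjugating letter, and then [c], the image of 1, is exchanged with [a] without touching
       [b]. *)
    assert (E0 : act (pconj 1 0) x = x) by (apply (Hx 0); lia).
    pose proof (Hstep 1 0 0 b ltac:(lia) ltac:(lia) ltac:(lia) Hb ltac:(lia) E0) as E1.
    set (c := swap 0 b 1) in *.
    assert (Hc : c < n /\ c <> b).
    { unfold c, swap. simpl. destruct b as [|[|b]]; simpl; lia. }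
    replace (swap 0 b 0) with b in E1 by reflexivity.
    pose proof (Hstep c b c a (proj1 Hc) Hb (proj1 Hc) Ha (proj2 Hc) E1) as E2.
    replace (swap c a c) with a in E2 by (unfold swap; now rewrite Nat.eqb_refl).
    replace (swap c a b) with b in E2; [exact E2|].
    unfold swap. destruct (Nat.eqb_spec b c); [lia|]. destruct (Nat.eqb_spec b a); [congruence|reflexivity].
Qed.

End Action.

Open Scope R_scope.

Theorem theoremA (n d : nat) (Hn : (4 <= n)%nat) (Hd : (d < Nat.div n 2)%nat)
  (X : Type) (dist : X -> X -> R)
  (Hmet : is_metric dist) (Hcomp : complete dist) (Hcat : CAT0 dist)
  (Hdim : covdim_eq dist d)
  (act : (W n -> W n) -> X -> X) (Hact : isometric_Aut_action dist act) :
  exists x : X, forall f : W n -> W n, is_aut f -> act f x = x.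
Proof.
  destruct Hdim as (Hle & [o] & _).
  destruct (all_blocks_fixed dist Hmet Hcomp Hcat o act Hact d n Hle Hd) as [x Hx]; [lia|].
  exists x. apply (fixed_by_all_automorphisms dist act Hact); [lia|exact Hx].
Qed.
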